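(* Let $k$ and $\mathcal O=\mathcal P(E,R)$ be as in the standing assumptions of the context. Let $A$ be a differential graded $\mathcal O$-algebra, $f\colon\tilde A\leadsto A$ a derived minimal model with induced horizontal resolution $\rho\colon\tilde A\to H_*(A)$, $\mu\in E(r)$ a generator, and $x_i\in H_*(A)$, $t_i\in k$ $(1\le i\le r)$ elements such that $t_ix_i=0$ for $1\le i\le r$ and $\sum_{i=1}^rt_i=0$. Write $\beta_i=|\mu|+\sum_{j=1}^{i-1}|x_j|$. Choose elements $u_i\in\tilde A_{0,|x_i|}$ such that $f(1)_0(u_i)\in A_{|x_i|}$ represents $x_i$, elements $v_i\in\tilde A_{1,|x_i|}$ satisfying $d_1(v_i)=t_iu_i$, $1\le i\le r$, and an element $w\in\tilde A_{2,|\mu|+\sum_{i=1}^r|x_i|}$ such that $$d_1(w)=\sum_{i=1}^r(-1)^{\beta_i}(s\mu)_0(u_1,\dots,u_{i-1},v_i,u_{i+1},\dots,u_r).$$ Then $$\sum_{i=1}^r(-1)^{\beta_i}\rho\big((s\mu)_1(u_1,\dots,v_i,\dots,u_r)\big)-\rho(d_2(w))\in H_{|\mu|+\sum_{i=1}^r|x_i|+1}(A)$$ belongs to the torsion Massey product $\langle x_1,\dots,x_r\rangle_\mu^{t_1,\dots,t_r}$.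
   Context: **Torsion Massey products.** Let $\mu\in E(r)$, $t_i\in k$ with $\sum_{i=1}^rt_i=0$, and homogeneous $x_i\in H_*(A)$ with $t_ix_i=0$, $1\le i\le r$. Choose cycles $y_i\in A_{|x_i|}$ representing $x_i$ and $z_i\in A_{|x_i|+1}$ with $d(z_i)=t_iy_i$. The torsion Massey product $$\langle x_1,\dots,x_r\rangle_\mu^{t_1,\dots,t_r}\in\frac{H_{|\mu|+|x_1|+\cdots+|x_r|+1}(A)}{\sum_{i=1}^r\mu(x_1,\dots,x_{i-1},H_{|x_i|+1}(A),x_{i+1},\dots,x_r)}$$ is the element represented by the homology class of the cycle $\sum_{i=1}^r(-1)^{\beta_i}\mu(y_1,\dots,y_{i-1},z_i,y_{i+1},\dots,y_r)$, $\beta_i=|\mu|+\sum_{j<i}|x_j|$; it is independent of choices and also regarded as a coset in $H_{|\mu|+\sum|x_i|+1}(A)$. **Standing assumptions.** $k$ is a commutative ring; complexes are $\mathbb Z$-graded chain complexes of $k$-modules and the Koszul sign rule is used. $\mathcal O=\mathcal P(E,R)$ is a graded (zero differential), $k$-projective, quadratic Koszul operad with generating $\mathbb S$-module $E$, $E(0)=0$, and relations $R\subset E\circ_{(1)}E$ (the weight $2$ part of the free operad on $E$); either $\mathbb Q\subset k$ or $\mathcal O$ is the symmetrization of a non-symmetric operad. **Koszul dual.** $s$ is the degree $1$ suspension. $\mathcal O^{¡}=\mathcal C(sE,s^2R)$ is the Koszul dual cooperad, weighted with $(\mathcal O^{¡})^{(0)}=I$ ($k$ in arity $1$, degree $0$),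 $(\mathcal O^{¡})^{(1)}=sE$, $(\mathcal O^{¡})^{(2)}=s^2R$. The map $\kappa\colon\mathcal O^{¡}\to\mathcal O$ is projection to $sE$, followed by $s^{-1}$ and the inclusion $E\subset\mathcal O$. The infinitesimal decomposition is written $\Delta_{(1)}(\mu)=\sum_{(\mu)}(\mu^{(1)}\circ_l\mu^{(2)})\cdot\sigma$. For $\mu\in E(r)$, $\Delta_{(1)}(s\mu)=1\circ_1 (s\mu)+\sum_i (s\mu)\circ_i1$; for $\Gamma=\sum(\mu^{(1)}\circ_l\mu^{(2)})\cdot\sigma\in R(r)$, $\Delta_{(1)}(s^2\Gamma)=1\circ_1(s^2\Gamma)+\sum_i(s^2\Gamma)\circ_i1+\sum(-1)^{|\mu^{(1)}|}((s\mu^{(1)})\circ_l(s\mu^{(2)}))\cdot\sigma$. **Derived homotopy algebras.** A homotopy $\mathcal O$-algebra ($\mathcal O_\infty=\Omega\mathcal O^{¡}$-algebra) is a complex $A$ with a degree $-1$ map of $\mathbb S$-modules $\phi\colon\mathcal O^{¡}\to\mathrm{End}_A$, written $\phi(\mu)(x_1,\dots,x_r)=\mu(x_1,\dots,x_r)$, with $\phi(1)=0$ and $\partial(\phi(\mu))+\sum_{(\mu)}(-1)^{|\mu^{(1)}|}(\phi(\mu^{(1)})\circ_l\phi(\mu^{(2)}))\cdot\sigma=0$, $\partial$ being the differential of $\mathrm{End}_A$. An $\infty$-morphism $f\colon A\leadsto B$ is a degree $0$ map of $\mathbb S$-modules $f\colon \mathcal O^{¡}\to\mathrm{End}^A_B$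 ($\mathrm{End}^A_B(r)=\mathrm{Hom}(A^{\otimes r},B)$) with $\partial f=f*\phi_A-\phi_B\circledast f$, where $(f*\phi_A)(\mu)=\sum_{(\mu)}(-1)^{|\mu^{(1)}|}(f(\mu^{(1)})\circ_l\phi_A(\mu^{(2)}))\cdot\sigma$ and $\phi_B\circledast f$ is the full decomposition $\Delta\colon\mathcal O^{¡}\to\mathcal O^{¡}\circ\mathcal O^{¡}$ followed by $\phi_B\circ f$ and composition of maps. A derived homotopy $\mathcal O$-algebra is a homotopy $\mathcal O$-algebra $A$ with a splitting $A_n=\bigoplus_{p+q=n}A_{p,q}$, $A_{p,q}=0$ for $p<0$ ($p$ is the horizontal degree, $p+q$ the total degree $|\cdot|$), such that $F_mA=\bigoplus_{p\le m}A_{p,q}$ satisfies $d(F_mA)\subset F_mA$ and $\mu(F_{m_1}A,\dots,F_{m_r}A)\subset F_{m_1+\cdots+m_r}A$. Hence $d=\sum_{i\ge0}d_i$ and $\mu(\cdots)=\sum_{i\geq 0}\mu_i(\cdots)$, where $d_i$ and $\mu_i$ lower the (sum of the) horizontal degree(s) by exactly $i$: $d_i\colon A_{p,q}\to A_{p-i,q-1+i}$. A derived $\infty$-morphism is an $\infty$-morphism $f$ with $f(\mu)(F_{m_1}A,\dots,F_{m_r}A)\subset F_{m_1+\cdots+m_r}B$; similarly $f(\mu)=\sum_{i\ge0} f(\mu)_i$. It is an $E^2$-equivalence if the filtered chain map $f(1)$ (whose effect on $E^1$ is induced by $f(1)_0$) is an isomorphism on $E^2$ pages of the spectral sequences of the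 filtrations. A differential graded $\mathcal O$-algebra is a derived homotopy $\mathcal O$-algebra concentrated in horizontal degree $0$ via $\kappa$ (so $(s\mu)_0=\mu$ for $\mu\in E$). A derived homotopy $\mathcal O$-algebra is minimal if $d_0=0$. A derived minimal model of a differential graded $\mathcal O$-algebra $A$ is an $E^2$-equivalence $f\colon\tilde A\leadsto A$ with $\tilde A$ a minimal $k$-projective derived homotopy $\mathcal O$-algebra. **The map $\rho$.** For a minimal model $f\colon\tilde A\leadsto A$, the map $f(1)_0\colon\tilde A\to A$ vanishes in positive horizontal degrees and takes values in cycles; $\rho\colon\tilde A\to H_*(A)$ is its composite with the projection from cycles to $H_*(A)$. Each complex $(\tilde A_{*,q},d_1)$ is a projective resolution of $H_q(A)$ via $\rho$. *)

(* Defs.v *)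
From HB Require Import structures.
From Stdlib Require List.
From mathcomp Require Import all_boot all_order all_algebra all_fingroup.
From mathcomp Require Import boolp classical_sets cardinality fsbigop.

Set Implicit Arguments.
Unset Strict Implicit.
Unset Printing Implicit Defensive.

Import Order.TTheory GRing.Theory Num.Theory.
Local Open Scope ring_scope.

#[local] Obligation Tactic := idtac.

(** A [premodule] is a type with module operations satisfying the module laws up
  to an equivalence relation; [pquot] is the module of equivalence classes.
  Homology modules and modules presented by generators and relations are the
  two instances. *)

Record premodule (k : comPzRingType) := Premodule {
  pm_car : Type;
  pm_eqv : pm_car -> pm_car -> Prop;
  pm_zero : pm_car;
  pm_add : pm_car -> pm_car -> pm_car;
  pm_opp : pm_car -> pm_car;
  pm_scale : k -> pm_car -> pm_car;
  pm_refl : forall x, pm_eqv x x;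
  pm_sym : forall x y, pm_eqv x y -> pm_eqv y x;
  pm_trans : forall x y z, pm_eqv x y -> pm_eqv y z -> pm_eqv x z;
  pm_addP : forall x x' y y', pm_eqv x x' -> pm_eqv y y' ->
    pm_eqv (pm_add x y) (pm_add x' y');
  pm_scaleP : forall c x x', pm_eqv x x' ->
    pm_eqv (pm_scale c x) (pm_scale c x');
  pm_addA : forall x y z,
    pm_eqv (pm_add x (pm_add y z)) (pm_add (pm_add x y) z);
  pm_addC : forall x y, pm_eqv (pm_add x y) (pm_add y x);
  pm_add0 : forall x, pm_eqv (pm_add pm_zero x) x;
  pm_addN : forall x, pm_eqv (pm_add (pm_opp x) x) pm_zero;
  pm_scaleA : forall a b x,
    pm_eqv (pm_scale a (pm_scale b x)) (pm_scale (a * b) x);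
  pm_scale1 : forall x, pm_eqv (pm_scale 1 x) x;
  pm_scaleDr : forall c x y,
    pm_eqv (pm_scale c (pm_add x y)) (pm_add (pm_scale c x) (pm_scale c y));
  pm_scaleDl : forall x a b,
    pm_eqv (pm_scale (a + b) x) (pm_add (pm_scale a x) (pm_scale b x)) }.

Definition pquot (k : comPzRingType) (P : premodule k) : Type :=
  {S : pm_car P -> Prop | exists x, S = pm_eqv x}.

Section PQuot.
Variables (k : comPzRingType) (P : premodule k).
Local Notation Q := (pquot P).

Definition pcls (x : pm_car P) : Q :=
  exist (fun S => exists x, S = pm_eqv x) (pm_eqv x) (ex_intro _ x erefl).

Definition prepr (q : Q) : pm_car P := sval (cid (svalP q)).

Lemma pclsP x y : pcls x = pcls y <-> pm_eqv x y.
Proof.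
split=> [/(congr1 sval) /= e | exy]; first by rewrite e; exact: pm_refl.
have e : pm_eqv x = pm_eqv y.
  apply/funext => z; apply/propext; split; apply: pm_trans => //.
  exact: pm_sym.
rewrite /pcls; move: (ex_intro _ x _) (ex_intro _ y _); rewrite e => a b.
by rewrite (Prop_irrelevance a b).
Qed.

Lemma preprK q : pcls (prepr q) = q.
Proof.
rewrite /prepr; case: cid => x /= e; case: q e => S ex /= e.
rewrite /pcls; move: (ex_intro _ x _); rewrite -e => a.
by rewrite (Prop_irrelevance a ex).
Qed.

Lemma preprE x : pm_eqv (prepr (pcls x)) x.
Proof. by apply/pclsP; rewrite preprK. Qed.

HB.instance Definition _ := gen_eqMixin Q.
HB.instance Definition _ := gen_choiceMixin Q.

Definition pq_add (p q : Q) : Q := pcls (pm_add (prepr p) (prepr q)).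
Definition pq_opp (p : Q) : Q := pcls (pm_opp (prepr p)).
Definition pq_scale (c : k) (p : Q) : Q := pcls (pm_scale c (prepr p)).

Lemma pq_addE x y : pq_add (pcls x) (pcls y) = pcls (pm_add x y).
Proof. by apply/pclsP/pm_addP; exact: preprE. Qed.
Lemma pq_scaleE c x : pq_scale c (pcls x) = pcls (pm_scale c x).
Proof. by apply/pclsP/pm_scaleP; exact: preprE. Qed.

Fact pq_addA : associative pq_add.
Proof.
move=> p q r; rewrite -(preprK p) -(preprK q) -(preprK r) !pq_addE.
by apply/pclsP/pm_addA.
Qed.
Fact pq_addC : commutative pq_add.
Proof. by move=> p q; apply/pclsP/pm_addC. Qed.
Fact pq_add0 : left_id (pcls (pm_zero P)) pq_add.
Proof.
move=> p; rewrite -{1}(preprK p) pq_addE -{2}(preprK p).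
exact/pclsP/pm_add0.
Qed.
Fact pq_addN : left_inverse (pcls (pm_zero P)) pq_opp pq_add.
Proof. by move=> p; rewrite -{2}(preprK p) pq_addE; apply/pclsP/pm_addN. Qed.

HB.instance Definition _ := GRing.isZmodule.Build Q pq_addA pq_addC pq_add0 pq_addN.

Fact pq_scaleA a b p : pq_scale a (pq_scale b p) = pq_scale (a * b) p.
Proof. by rewrite -(preprK p) !pq_scaleE; apply/pclsP/pm_scaleA. Qed.
Fact pq_scale1 : left_id 1 pq_scale.
Proof. by move=> p; rewrite -{2}(preprK p); apply/pclsP/pm_scale1. Qed.
Fact pq_scaleDr : right_distributive pq_scale +%R.
Proof.
move=> c p q; rewrite -(preprK p) -(preprK q) [X in pq_scale _ X]pq_addE.
by rewrite !pq_scaleE [RHS]pq_addE; apply/pclsP/pm_scaleDr.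
Qed.
Fact pq_scaleDl p : {morph pq_scale^~ p : a b / a + b}.
Proof.
move=> a b /=; rewrite -(preprK p) !pq_scaleE [RHS]pq_addE.
exact/pclsP/pm_scaleDl.
Qed.

HB.instance Definition _ := GRing.Zmodule_isLmodule.Build k Q
  pq_scaleA pq_scale1 pq_scaleDr pq_scaleDl.

End PQuot.

(** Formal linear combinations are lists of pairs (coefficient, generator).  Two
  of them are equal in the presented module iff they have the same value under
  every function on the generators which kills the relators. *)

Definition fsum (k : comPzRingType) (X : Type) := seq (k * X).

Section Presented.
Variables (k : comPzRingType) (X : Type) (rel : fsum k X -> Prop).

Definition feval (M : lmodType k) (F : X -> M) (x : fsum k X) : M :=
  \sum_(p <- x) p.1 *: F p.2.

Definition fscale (c : k) (x : fsum k X) : fsum k X :=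
  [seq (c * p.1, p.2) | p <- x].

Definition pres_eqv (x y : fsum k X) : Prop :=
  forall (M : lmodType k) (F : X -> M),
    (forall z, rel z -> feval F z = 0) -> feval F x = feval F y.

Lemma feval_cat (M : lmodType k) (F : X -> M) x y :
  feval F (x ++ y) = feval F x + feval F y.
Proof. by rewrite /feval big_cat. Qed.

Lemma feval_scale (M : lmodType k) (F : X -> M) c x :
  feval F (fscale c x) = c *: feval F x.
Proof.
rewrite /feval /fscale big_map scaler_sumr.
by apply: eq_bigr => p _; rewrite scalerA.
Qed.

Program Definition pres_pm : premodule k :=
  @Premodule k (fsum k X) pres_eqv [::] cat (fscale (-1)) fscale
    _ _ _ _ _ _ _ _ _ _ _ _ _.
Next Obligation. by []. Qed.
Next Obligation. by move=> x y e M F h; rewrite e. Qed.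
Next Obligation. by move=> x y z e e' M F h; rewrite e // e'. Qed.
Next Obligation. by move=> x x' y y' e e' M F h; rewrite !feval_cat e // e'. Qed.
Next Obligation. by move=> c x x' e M F h; rewrite !feval_scale e. Qed.
Next Obligation. by move=> x y z M F h; rewrite catA. Qed.
Next Obligation. by move=> x y M F h; rewrite !feval_cat addrC. Qed.
Next Obligation. by []. Qed.
Next Obligation.
by move=> x M F h; rewrite feval_cat feval_scale scaleN1r addNr /feval big_nil.
Qed.
Next Obligation. by move=> a b x M F h; rewrite !feval_scale scalerA. Qed.
Next Obligation. by move=> x M F h; rewrite feval_scale scale1r. Qed.
Next Obligation.
by move=> c x y M F h; rewrite !(feval_cat, feval_scale) scalerDr.
Qed.
Next Obligation.
by move=> x a b M F h; rewrite !(feval_cat, feval_scale) scalerDl.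
Qed.

Definition pres : lmodType k := pquot pres_pm.

Definition fcls (x : fsum k X) : pres := pcls (x : pm_car pres_pm).
Definition frepr (q : pres) : fsum k X := prepr q.

End Presented.

Definition ksgn (k : comPzRingType) (n : int) : k := (-1) ^+ `|n|%N.

Definition zsum (s : seq int) : int := \sum_(n <- s) n.

(** Exponent of the Koszul sign of x_0...x_{r-1} |-> x_{s_0}...x_{s_{r-1}},
    where [ds] is the list of degrees of the x_i. *)
Fixpoint kexp (ds : seq int) (s : seq nat) : int :=
  if s is a :: s' then
    \sum_(b <- s' | (b < a)%N) nth 0 ds a * nth 0 ds b + kexp ds s'
  else 0.

Definition permlist (r : nat) (s : seq nat) : bool := perm_eq s (iota 0 r).

(** One-line notation of the inverse of a permutation. *)
Definition invlist (r : nat) (sigma : 'S_r) : seq nat :=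
  [seq nat_of_ord (perm_inv sigma i) | i <- enum 'I_r].

(** A Z-grading of a module, as a direct sum decomposition given by its
    projections. *)
Record grading (k : comPzRingType) (V : lmodType k) := Grading {
  gproj : int -> {linear V -> V};
  gproj_proj : forall m n x,
    gproj m (gproj n x) = if m == n then gproj n x else 0;
  gproj_sum : forall x, exists2 s : seq int, uniq s &
    x = \sum_(n <- s) gproj n x }.

Definition ghom (k : comPzRingType) (V : lmodType k) (g : grading V) (n : int)
  (x : V) : Prop := gproj g n x = x.

Record complex (k : comPzRingType) := Complex {
  ccar :> lmodType k;
  cgr : grading ccar;
  cd : {linear ccar -> ccar};
  cd_deg : forall n x, ghom cgr n x -> ghom cgr (n - 1) (cd x);
  cdd : forall x, cd (cd x) = 0 }.

Section Homology.
Variables (k : comPzRingType) (A : complex k).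

Definition cycle := {x : A | cd A x = 0}.

Fact cyc0_subproof : cd A 0 = 0. Proof. exact: raddf0. Qed.
Fact cycD_subproof (x y : cycle) : cd A (sval x + sval y) = 0.
Proof. by case: x y => [x hx] [y hy]; rewrite raddfD /= hx hy addr0. Qed.
Fact cycN_subproof (x : cycle) : cd A (- sval x) = 0.
Proof. by case: x => x hx; rewrite raddfN /= hx oppr0. Qed.
Fact cycZ_subproof c (x : cycle) : cd A (c *: sval x) = 0.
Proof. by case: x => x hx; rewrite linearZ /= hx scaler0. Qed.

Definition homologous (x y : cycle) : Prop :=
  exists b : A, sval x - sval y = cd A b.

Lemma homologous_eq (x y : cycle) : sval x = sval y -> homologous x y.
Proof. by move=> e; exists 0; rewrite e subrr raddf0. Qed.

Program Definition homology_pm : premodule k :=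
  @Premodule k cycle homologous (exist _ 0 cyc0_subproof)
    (fun x y => exist _ (sval x + sval y) (cycD_subproof x y))
    (fun x => exist _ (- sval x) (cycN_subproof x))
    (fun c x => exist _ (c *: sval x) (cycZ_subproof c x))
    _ _ _ _ _ _ _ _ _ _ _ _ _.
Next Obligation. by move=> x; apply: homologous_eq. Qed.
Next Obligation. by move=> x y [b e]; exists (- b); rewrite raddfN /= -e opprB. Qed.
Next Obligation.
by move=> x y z [b e] [c e']; exists (b + c); rewrite raddfD /= -e -e' addrA subrK.
Qed.
Next Obligation.
move=> x x' y y' [b e] [c e']; exists (b + c).
by rewrite [RHS]raddfD /= -e -e' opprD addrACA.
Qed.
Next Obligation.
by move=> c x x' [b e]; exists (c *: b); rewrite [RHS]linearZ /= -e scalerBr.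
Qed.
Next Obligation. by move=> x y z; apply: homologous_eq; rewrite /= addrA. Qed.
Next Obligation. by move=> x y; apply: homologous_eq; rewrite /= addrC. Qed.
Next Obligation. by move=> x; apply: homologous_eq; rewrite /= add0r. Qed.
Next Obligation. by move=> x; apply: homologous_eq; rewrite /= addNr. Qed.
Next Obligation. by move=> a b x; apply: homologous_eq; rewrite /= scalerA. Qed.
Next Obligation. by move=> x; apply: homologous_eq; rewrite /= scale1r. Qed.
Next Obligation. by move=> c x y; apply: homologous_eq; rewrite /= scalerDr. Qed.
Next Obligation. by move=> x a b; apply: homologous_eq; rewrite /= scalerDl. Qed.

(** The homology module, i.e. the direct sum of all the [H_n(A)]. *)
Definition homology : lmodType k := pquot homology_pm.

(** The class of a cycle; 0 by convention on elements which are not cycles. *)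
Definition hclass (x : A) : homology :=
  match pselect (cd A x = 0) with
  | left h => pcls (exist _ x h : pm_car homology_pm)
  | right _ => 0
  end.

Definition represents (y : A) (x : homology) : Prop :=
  cd A y = 0 /\ hclass y = x.

Definition hdeg (n : int) (x : homology) : Prop :=
  exists2 y, ghom (cgr A) n y & represents y x.

End Homology.

(** A map A^{(x) r} -> B is represented by a function on lists of elements of A,
  of which only the values on lists of length r are relevant. *)

Section Multilinear.
Variable k : comPzRingType.

Definition homs (A : complex k) (ds : seq int) (xs : seq A) : Prop :=
  size ds = size xs /\
  forall i, (i < size xs)%N -> ghom (cgr A) (nth 0 ds i) (nth 0 xs i).

Definition multilinear (A B : lmodType k) (r : nat) (g : seq A -> B) : Prop :=
  forall (xs ys : seq A) (c : k) (x y : A), (size xs + size ys).+1 = r ->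
    g (xs ++ (c *: x + y) :: ys) = c *: g (xs ++ x :: ys) + g (xs ++ y :: ys).

Definition is_end_elt (A B : complex k) (r : nat) (n : int) (g : seq A -> B)
  : Prop :=
  multilinear r g /\
  forall ds xs, size xs = r -> homs ds xs -> ghom (cgr B) (zsum ds + n) (g xs).

(** In the following definitions [ds] are the degrees of the homogeneous
    elements [xs]. *)

(** The differential of Hom(A^{(x) r}, B) on a map [g] of degree [n]. *)
Definition end_diff (A B : complex k) (n : int) (g : seq A -> B)
    (ds : seq int) (xs : seq A) : B :=
  cd B (g xs) - ksgn k n *:
    \sum_(i < size xs) ksgn k (zsum (take i ds)) *:
      g (take i xs ++ cd A (nth 0 xs i) :: drop i.+1 xs).

(** The right action of the permutation with inverse [s]. *)
Definition end_perm (A B : lmodType k) (s : seq nat)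
    (g : seq int -> seq A -> B) (ds : seq int) (xs : seq A) : B :=
  ksgn k (kexp ds s) *: g [seq nth 0 ds i | i <- s] [seq nth 0 xs i | i <- s].

(** The composite of [g] with a map [h] of arity [n] and degree [b] at the
    input [l]; inputs are numbered from 0. *)
Definition end_pcomp (A B : complex k) (l n : nat) (b : int)
    (g : seq A -> B) (h : seq A -> A) (ds : seq int) (xs : seq A) : B :=
  ksgn k (b * zsum (take l ds)) *:
    g (take l xs ++ h (take n (drop l xs)) :: drop (l + n) xs).

(** The Koszul sign exponent and the factors of (h_1 (x) ... (x) h_m)(xs), where
    each h_j is given with its arity and degree; [acc] is the total degree of
    the inputs of the previous factors. *)
Fixpoint end_tens (A B : complex k) (acc : int)
    (hs : seq (nat * int * (seq A -> B))) (ds : seq int) (xs : seq A)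
    : int * seq B :=
  if hs is (n, b, h) :: hs' then
    let rest := end_tens (acc + zsum (take n ds)) hs' (drop n ds) (drop n xs) in
    (b * acc + rest.1, h (take n xs) :: rest.2)
  else (0, [::]).

Definition end_comp (A B : complex k) (g : seq B -> B)
    (hs : seq (nat * int * (seq A -> B))) (ds : seq int) (xs : seq A) : B :=
  let t := end_tens 0 hs ds xs in ksgn k t.1 *: g t.2.

End Multilinear.

Record smodule (k : comPzRingType) := SModule {
  scar :> nat -> int -> lmodType k;
  sact : forall r n, 'S_r -> {linear scar r n -> scar r n};
  sact1 : forall r n (e : scar r n), sact n 1%g e = e;
  (* e.sigma.tau = e.(sigma o tau), and [tau * sigma] is sigma o tau *)
  sactM : forall r n (sigma tau : 'S_r) (e : scar r n),
    sact n tau (sact n sigma e) = sact n (tau * sigma)%g e }.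

(** Trees with leaves labelled by natural numbers.  A vertex
    [Node b e ts] is decorated by the generator [e] of E if [b = false] and by
    its suspension [s e] if [b = true].  A [Cut] is a mark on an edge; it behaves
    as a unary vertex of degree 0, and is used to write a tree as a composite of
    trees.  A tree stands for the tensor product of its decorations in prefix
    order, hence all signs below. *)
Inductive tree (k : comPzRingType) (E : smodule k) : Type :=
| Leaf of nat
| Cut of tree E
| Node (b : bool) (r : nat) (n : int) (e : E r n) (ts : seq (tree E)).
Arguments Leaf {k E}.

Section Trees.
Variables (k : comPzRingType) (E : smodule k).
Local Notation tree := (tree E).
Local Notation fsum := (fsum k tree).

Fixpoint twf (t : tree) : bool :=
  match t with
  | Leaf _ => true
  | Cut u => twf u
  | Node _ r _ _ ts => (size ts == r) && all twf ts
  end.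

(** All vertices are of type [b], and there are no cuts. *)
Fixpoint tpure (b : bool) (t : tree) : bool :=
  match t with
  | Leaf _ => true
  | Cut _ => false
  | Node b' _ _ _ ts => (b' == b) && all (tpure b) ts
  end.

Fixpoint leaves (t : tree) : seq nat :=
  match t with
  | Leaf a => [:: a]
  | Cut u => leaves u
  | Node _ _ _ _ ts => flatten (map leaves ts)
  end.

Fixpoint tdeg (t : tree) : int :=
  match t with
  | Leaf _ => 0
  | Cut u => tdeg u
  | Node b _ n _ ts => n + (b : nat)%:Z + zsum (map tdeg ts)
  end.

Fixpoint weight (t : tree) : nat :=
  match t with
  | Leaf _ => 0
  | Cut u => weight u
  | Node _ _ _ _ ts => (sumn (map weight ts)).+1
  end.

Fixpoint relabel (g : nat -> nat) (t : tree) : tree :=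
  match t with
  | Leaf a => Leaf (g a)
  | Cut u => Cut (relabel g u)
  | Node b _ _ e ts => Node b e (map (relabel g) ts)
  end.

Fixpoint setflag (b : bool) (t : tree) : tree :=
  match t with
  | Leaf a => Leaf a
  | Cut u => Cut (setflag b u)
  | Node _ _ _ e ts => Node b e (map (setflag b) ts)
  end.

(** Degrees of vertices and labels of leaves in prefix order. *)
Fixpoint tword (t : tree) : seq (int + nat) :=
  match t with
  | Leaf a => [:: inr a]
  | Cut u => tword u
  | Node b _ n _ ts => inl (n + (b : nat)%:Z) :: flatten (map tword ts)
  end.

(** Substitution of the tree [us_a] for the leaf labelled [a]. *)
Fixpoint graft (us : seq tree) (t : tree) : tree :=
  match t with
  | Leaf a => nth (Leaf a) us a
  | Cut u => Cut (graft us u)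
  | Node b _ _ e ts => Node b e (map (graft us) ts)
  end.

(** Sign exponent of [graft]: the Koszul sign of moving
    t (x) us_0 (x) us_1 (x) ... into prefix order. *)
Fixpoint wexp (dus : seq int) (w : seq (int + nat)) : int :=
  match w with
  | [::] => 0
  | inl _ :: w' => wexp dus w'
  | inr a :: w' =>
      nth 0 dus a * zsum [seq match x with
                              | inl d => d
                              | inr b => if (b < a)%N then nth 0 dus b else 0
                              end | x <- w'] + wexp dus w'
  end.

Definition graft_exp (us : seq tree) (t : tree) : int :=
  wexp (map tdeg us) (tword t).

Definition tone (t : tree) : fsum := [:: (1, t)].

Definition fmap (h : tree -> tree) (x : fsum) : fsum :=
  [seq (p.1, h p.2) | p <- x].

Definition fbind (h : tree -> fsum) (x : fsum) : fsum :=
  flatten [seq fscale p.1 (h p.2) | p <- x].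

(** The multilinear expansion of a list of formal sums. *)
Fixpoint fchoices (ys : seq fsum) : seq (k * seq tree) :=
  if ys is y :: ys' then
    [seq (p.1 * q.1, p.2 :: q.2) | p <- y, q <- fchoices ys']
  else [:: (1, [::])].

Definition fgraft (ys : seq fsum) (x : fsum) : fsum :=
  [seq (ksgn k (graft_exp q.2 p.2) * (p.1 * q.1), graft q.2 p.2)
     | p <- x, q <- fchoices ys].

(** Elements of arity [r] have leaves labelled by 0, ..., r-1.  The right action
    of the permutation with inverse [s] is [frelabel (nth 0 s)]. *)
Definition frelabel (g : nat -> nat) : fsum -> fsum := fmap (relabel g).

Definition fperm (s : seq nat) : fsum -> fsum := frelabel (nth 0%N s).

(** x o_l y, where [m] and [n] are the arities of x and y; 0 <= l < m. *)
Definition fpcomp (m l n : nat) (x y : fsum) : fsum :=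
  fgraft ([seq tone (Leaf a) | a <- iota 0 l] ++ frelabel (addn l) y
            :: [seq tone (Leaf a) | a <- iota (l + n) (m - l.+1)]) x.

Fixpoint fshift (off : nat) (ys : seq (nat * fsum)) : seq fsum :=
  if ys is (n, y) :: ys' then frelabel (addn off) y :: fshift (off + n) ys'
  else [::].

(** x (y_1, ..., y_m), where each y_j is given with its arity. *)
Definition fcomp (x : fsum) (ys : seq (nat * fsum)) : fsum :=
  fgraft (fshift 0 ys) x.

Definition corolla (b : bool) (r : nat) (n : int) (e : E r n) : tree :=
  Node b e [seq Leaf a | a <- iota 0 r].

(** Homogeneous formal sums of arity [r] and degree [n] in the free operad on
    E if [b = false] and on sE if [b = true]. *)
Definition fhom (b : bool) (r : nat) (n : int) (x : fsum) : bool :=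
  all (fun p => [&& twf p.2, tpure b p.2, permlist r (leaves p.2)
                  & tdeg p.2 == n]) x.

(** Multilinearity and equivariance of decorations, together with the operadic
  ideal generated by the formal sums in [RR] (given with their arities). *)
Inductive trel (RR : nat -> fsum -> Prop) : fsum -> Prop :=
| trel_lin b r n (c : k) (e e' : E r n) ts : size ts = r ->
    trel RR [:: (1, Node b (c *: e + e') ts); (- c, Node b e ts);
                (- 1, Node b e' ts)]
| trel_perm b r n (sigma : 'S_r) (e : E r n) ts : size ts = r ->
    trel RR [:: (1, Node b (sact E n sigma e) ts);
                (- ksgn k (kexp (map tdeg ts) (invlist sigma)),
                 Node b e [seq nth (Leaf 0) ts i | i <- invlist sigma])]
| trel_ideal r x us : RR r x -> size us = r ->
    trel RR (fgraft (map tone us) x)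
| trel_node b r n (e : E r n) ts1 ts2 x :
    (size ts1 + size ts2).+1 = r -> trel RR x ->
    trel RR (fmap (fun t => Node b e (ts1 ++ t :: ts2)) x)
| trel_cut x : trel RR x -> trel RR (fmap (@Cut k E) x).

Definition trees (RR : nat -> fsum -> Prop) : lmodType k := pres (trel RR).

Definition tcls (RR : nat -> fsum -> Prop) (x : fsum) : trees RR :=
  fcls (trel RR) x.

(** The tree module containing the free operads T(E) and T(sE) and their
    composites. *)
Definition noRR (r : nat) (x : fsum) : Prop := False.
Definition ftrees : lmodType k := trees noRR.
Definition fc (x : fsum) : ftrees := tcls noRR x.

(** Graded sub-S-modules of a quotient of T(E) or T(sE). *)
Definition sub_smodule (RR : nat -> fsum -> Prop) (b : bool)
    (C : nat -> int -> trees RR -> Prop) : Prop :=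
  [/\ forall r n xi, C r n xi -> exists2 x, fhom b r n x & tcls RR x = xi,
      forall r n, C r n 0,
      forall r n c xi xi', C r n xi -> C r n xi' -> C r n (c *: xi + xi')
    & forall r n x s, fhom b r n x -> permlist r s ->
        C r n (tcls RR x) -> C r n (tcls RR (fperm s x)) ].

End Trees.

Record quadratic_data (k : comPzRingType) := QuadraticData {
  qE : smodule k;
  qR : nat -> int -> ftrees qE -> Prop;
  qR_sub : sub_smodule false qR;
  qR_weight : forall r n xi, qR r n xi -> exists x,
    [/\ fhom false r n x, all (fun p => weight p.2 == 2) x & fc x = xi] }.

Section Quadratic.
Variables (k : comPzRingType) (Q : quadratic_data k).
Local Notation E := (qE Q).
Local Notation fsum := (fsum k (tree E)).

Definition qRR (r : nat) (x : fsum) : Prop :=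
  exists n, [/\ fhom false r n x, all (fun p => weight p.2 == 2) x
              & qR r n (fc x)].

(** Trees modulo relations.  The trees with vertices of type [false] and no cuts
    span O = P(E,R); those in which no vertex of type [true] descends from one of
    type [false] span T(sE) o O. *)
Definition otrees : lmodType k := trees qRR.
Definition oc (x : fsum) : otrees := tcls qRR x.

Definition operad (r : nat) (n : int) (xi : otrees) : Prop :=
  exists2 x, fhom false r n x & oc x = xi.

(** The tree cooperad T^c(sE): the decomposition sums over all ways of cutting
    each path from the root to a leaf once. *)
Fixpoint decomp (t : tree E) : fsum :=
  tone (Cut t) ++
  match t with
  | Node b _ _ e ts =>
      [seq (q.1, Node b e q.2) | q <- fchoices (map decomp ts)]
  | _ => [::]
  end.

(** The infinitesimal decomposition sums over all ways of cutting one edge, the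
    root and the leaves included. *)
Fixpoint idecomp (t : tree E) : fsum :=
  tone (Cut t) ++
  match t with
  | Node b _ _ e ts =>
      let us := map idecomp ts in
      flatten [seq fmap (fun u => Node b e (take i ts ++ u :: drop i.+1 ts))
                     (nth [::] us i) | i <- iota 0 (size ts)]
  | _ => [::]
  end.

(** The decompositions, like all operations on formal sums, are compatible with
    the relations, so it does not matter which formal sum represents an element.

    A homogeneous element of a sub-S-module of T(sE), given by a formal sum,
    with its arity and degree. *)
Record elt := Elt { ear : nat; edeg : int; eform : fsum }.

Definition elt_in (C : nat -> int -> ftrees E -> Prop) (y : elt) : Prop :=
  fhom true (ear y) (edeg y) (eform y) /\ C (ear y) (edeg y) (fc (eform y)).

(** A term (upper o_pos lower).sigma; [perm] is the inverse of sigma. *)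
Record iterm := ITerm { iupper : elt; ipos : nat; ilower : elt; iperm : seq nat }.

(** A term (upper; lower_1, ..., lower_m).sigma *)
Record cterm := CTerm { cupper : elt; clower : seq elt; cperm : seq nat }.

(** [L] is an expression of the infinitesimal decomposition of [x] as a sum
    of composites of elements of [C]. *)
Definition idecomposes (C : nat -> int -> ftrees E -> Prop) (r : nat) (n : int)
    (x : fsum) (L : seq iterm) : Prop :=
  List.Forall (fun T : iterm =>
    let y := iupper T in let z := ilower T in
    [/\ elt_in C y /\ elt_in C z, (ipos T < ear y)%N,
        (ear y + ear z)%N = r.+1, edeg y + edeg z = n & permlist r (iperm T)]) L /\
  fc (fbind idecomp x) =
    \sum_(T <- L)
      fc (fperm (iperm T)
           (fpcomp (ear (iupper T)) (ipos T) (ear (ilower T))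
              (eform (iupper T)) (fmap (@Cut k E) (eform (ilower T))))).

Definition decomposes (C : nat -> int -> ftrees E -> Prop) (r : nat) (n : int)
    (x : fsum) (L : seq cterm) : Prop :=
  List.Forall (fun T : cterm =>
    let y := cupper T in let zs := clower T in
    [/\ elt_in C y /\ List.Forall (elt_in C) zs, ear y = size zs,
        sumn (map ear zs) = r, edeg y + zsum (map edeg zs) = n
      & permlist r (cperm T)]) L /\
  fc (fbind decomp x) =
    \sum_(T <- L)
      fc (fperm (cperm T)
           (fcomp (eform (cupper T))
              [seq (ear z, fmap (@Cut k E) (eform z)) | z <- clower T])).

(** s^2 of a formal sum of trees with two vertices; [tree_rootdeg] is the degree
    of the root vertex. *)
Definition tree_rootdeg (t : tree E) : int :=
  if t is Node _ _ n _ _ then n else 0.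

Definition s2 (z : fsum) : fsum :=
  [seq (ksgn k (tree_rootdeg p.2) * p.1, setflag true p.2) | p <- z].

Definition s2R (r : nat) (n : int) (xi : ftrees E) : Prop :=
  exists z, [/\ fhom false r (n - 2) z, all (fun p => weight p.2 == 2) z,
                qR r (n - 2) (fc z) & fc (s2 z) = xi].

Definition subcooperad (C : nat -> int -> ftrees E -> Prop) : Prop :=
  sub_smodule true C /\
  forall r n xi, C r n xi ->
    exists x L, [/\ fhom true r n x, fc x = xi & decomposes C r n x L].

(** The composite of C -> T^c(sE) and T^c(sE) ->> T^c(sE)^(2) / s^2R vanishes. *)
Definition weight2_in_s2R (C : nat -> int -> ftrees E -> Prop) : Prop :=
  forall r n xi, C r n xi ->
    exists x, [/\ fhom true r n x, fc x = xi
                & s2R r n (fc [seq p <- x | weight p.2 == 2])].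

(** The Koszul dual cooperad C(sE, s^2R): the largest sub-cooperad of T^c(sE)
    with weight 2 part in s^2R. *)
Definition kdual (r : nat) (n : int) (xi : ftrees E) : Prop :=
  exists C, [/\ subcooperad C, weight2_in_s2R C & C r n xi].

Definition kunit : ftrees E := fc (tone (Leaf 0)).

Definition susp (r : nat) (n : int) (mu : E r n) : ftrees E :=
  fc (tone (corolla true mu)).

Definition generator (r : nat) (n : int) (mu : E r n) : otrees :=
  oc (tone (corolla false mu)).

(** The twisting morphism; its value does not depend on the representative. *)
Definition kappa (xi : ftrees E) : otrees :=
  feval (fun t => if tpure true t && (weight t == 1)
                  then oc (tone (setflag false t)) else 0)
        (frepr xi).

(** The Koszul complex is O^! o O, inside the trees with vertices of type [true]
  (the part in T(sE)) whose descendants may be vertices of type [false] (the part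
  in O).  The differential applies kappa to the vertices of type [true] without
  descendants of type [true]. *)
Fixpoint has_susp (t : tree E) : bool :=
  match t with
  | Leaf _ => false
  | Cut u => has_susp u
  | Node b _ _ _ ts => b || has has_susp ts
  end.

Fixpoint koszul_diff (t : tree E) : fsum :=
  match t with
  | Node b _ n e ts =>
      let us := map koszul_diff ts in
      (if b && ~~ has has_susp ts then tone (Node false e ts) else [::]) ++
      flatten [seq fscale (ksgn k (n + (b : nat)%:Z
                                   + zsum (map (@tdeg k E) (take i ts))))
                     (fmap (fun u => Node b e (take i ts ++ u :: drop i.+1 ts))
                        (nth [::] us i)) | i <- iota 0 (size ts)]
  | _ => [::]
  end.

(** The formal sum of the composites (upper; lower_1, ..., lower_m).sigma *)
Definition kos_sum (L : seq cterm) : fsum :=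
  flatten [seq fperm (cperm T)
                 (fcomp (eform (cupper T)) [seq (ear z, eform z) | z <- clower T])
             | T <- L].

(** Arity [r], degree [n], weight [w] part of O^! o O. *)
Definition kos_elt (r : nat) (n : int) (w : nat) (L : seq cterm) : Prop :=
  List.Forall (fun T : cterm =>
    let y := cupper T in let zs := clower T in
    [/\ elt_in kdual y /\ all (fun z => fhom false (ear z) (edeg z) (eform z)) zs,
        ear y = size zs, sumn (map ear zs) = r, edeg y + zsum (map edeg zs) = n
      & permlist r (cperm T)]) L /\
  all (fun p => weight p.2 == w) (kos_sum L).

(** The Koszul complex is acyclic, i.e. it is exact in positive weights (its
    weight 0 part is the unit S-module). *)
Definition koszul : Prop :=
  forall r n w L, (0 < w)%N -> kos_elt r n w L ->
    oc (fbind koszul_diff (kos_sum L)) = 0 ->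
    exists2 L', kos_elt r (n + 1) w L' &
      oc (fbind koszul_diff (kos_sum L')) = oc (kos_sum L).

(** O is the symmetrization of a non-symmetric operad: it has a non-symmetric
    suboperad N such that O(r) is the direct sum of the N(r).sigma. *)
Definition is_symmetrization : Prop :=
  exists N : nat -> int -> otrees -> Prop,
  [/\ forall r n xi, N r n xi -> operad r n xi,
      (forall r n, N r n 0) /\
      (forall r n c xi xi', N r n xi -> N r n xi' -> N r n (c *: xi + xi')),
      N 1 0 (oc (tone (Leaf 0))),
      (forall m a n b l x y, fhom false m a x -> fhom false n b y ->
         (l < m)%N -> N m a (oc x) -> N n b (oc y) ->
         N (m + n).-1 (a + b) (oc (fpcomp m l n x y)))
    & (forall r n xi, operad r n xi -> exists2 Y : 'S_r -> fsum,
         forall sigma, fhom false r n (Y sigma) /\ N r n (oc (Y sigma))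
         & xi = \sum_(sigma : 'S_r) oc (fperm (invlist sigma) (Y sigma))) /\
      (forall r n (Y : 'S_r -> fsum),
         (forall sigma, fhom false r n (Y sigma) /\ N r n (oc (Y sigma))) ->
         \sum_(sigma : 'S_r) oc (fperm (invlist sigma) (Y sigma)) = 0 ->
         forall sigma, oc (Y sigma) = 0)].

End Quadratic.

Arguments oc {k} Q x.
Arguments operad {k} Q r n xi.
Arguments kdual {k} Q r n xi.

Definition linear_on (k : comPzRingType) (V W : lmodType k) (P : V -> Prop)
    (h : V -> W) : Prop :=
  forall c x y, P x -> P y -> h (c *: x + y) = c *: h x + h y.

(** The submodule [P] of [V] is a projective module. *)
Definition projective_on (k : comPzRingType) (V : lmodType k) (P : V -> Prop)
    : Prop :=
  forall (M N : lmodType k) (g : {linear M -> N}) (h : V -> N),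
    (forall y, exists x, g x = y) -> linear_on P h ->
    exists2 h' : V -> M, linear_on P h' & forall x, P x -> g (h' x) = h x.

Definition contains_rationals (k : comPzRingType) : Prop :=
  forall n : nat, exists u : k, n.+1%:R * u = 1.

Record standing_assumptions (k : comPzRingType) (Q : quadratic_data k) : Prop := {
  st_reduced : forall n (e : qE Q 0%N n), e = 0;
  st_projective : forall r n, projective_on (operad Q r n);
  st_koszul : koszul Q;
  st_sym : contains_rationals k \/ is_symmetrization Q }.

Section Algebras.
Variables (k : comPzRingType) (Q : quadratic_data k).
Local Notation E := (qE Q).
Local Notation fsum := (fsum k (tree E)).

(** A degree [e] map of S-modules C -> Hom(A^{(x) *}, B). *)
Definition is_smap (RR : nat -> fsum -> Prop) (b : bool)
    (C : nat -> int -> trees RR -> Prop) (e : int) (A B : complex k)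
    (phi : trees RR -> seq A -> B) : Prop :=
  [/\ forall r n xs, size xs = r -> linear_on (C r n) (fun xi => phi xi xs),
      forall r n xi, C r n xi -> is_end_elt r (n + e) (phi xi)
    & forall r n x s ds xs, fhom b r n x -> C r n (tcls RR x) ->
        permlist r s -> size xs = r -> homs ds xs ->
        phi (tcls RR (fperm s x)) xs
          = end_perm s (fun _ => phi (tcls RR x)) ds xs].

(** Differential graded O-algebras: [ga_act] is a morphism of differential
    graded operads O -> End_A. *)
Record dgalg := DGAlg {
  ga_cx :> complex k;
  ga_act : otrees Q -> seq ga_cx -> ga_cx;
  ga_smap : is_smap false (operad Q) 0 ga_act;
  ga_unit : forall x, ga_act (oc Q (tone (Leaf 0))) [:: x] = x;
  ga_comp : forall m a n b l x y ds xs,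
    fhom false m a x -> fhom false n b y -> (l < m)%N ->
    (size xs).+1 = (m + n)%N -> homs ds xs ->
    ga_act (oc Q (fpcomp m l n x y)) xs
      = end_pcomp l n b (ga_act (oc Q x)) (ga_act (oc Q y)) ds xs;
  ga_diff : forall r n xi ds xs, operad Q r n xi -> size xs = r -> homs ds xs ->
    end_diff n (ga_act xi) ds xs = 0 }.

Definition is_hoalg (A : complex k) (phi : ftrees E -> seq A -> A) : Prop :=
  [/\ is_smap true (kdual Q) (-1) phi,
      forall x, phi (kunit Q) [:: x] = 0
    & forall r n x L ds xs,
        fhom true r n x -> kdual Q r n (fc x) ->
        idecomposes (kdual Q) r n x L -> size xs = r -> homs ds xs ->
        end_diff (n - 1) (phi (fc x)) ds xs
        + \sum_(T <- L) ksgn k (edeg (iupper T)) *: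
            end_perm (iperm T)
              (end_pcomp (ipos T) (ear (ilower T)) (edeg (ilower T) - 1)
                 (phi (fc (eform (iupper T)))) (phi (fc (eform (ilower T)))))
              ds xs
        = 0].

Definition is_infmor (A : complex k) (phiA : ftrees E -> seq A -> A)
    (B : complex k) (phiB : ftrees E -> seq B -> B)
    (f : ftrees E -> seq A -> B) : Prop :=
  is_smap true (kdual Q) 0 f /\
  forall r n x Li Lc ds xs,
    fhom true r n x -> kdual Q r n (fc x) ->
    idecomposes (kdual Q) r n x Li -> decomposes (kdual Q) r n x Lc ->
    size xs = r -> homs ds xs ->
    end_diff n (f (fc x)) ds xs =
      \sum_(T <- Li) ksgn k (edeg (iupper T)) *:
        end_perm (iperm T)
          (end_pcomp (ipos T) (ear (ilower T)) (edeg (ilower T) - 1)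
             (f (fc (eform (iupper T)))) (phiA (fc (eform (ilower T)))))
          ds xs
      - \sum_(T <- Lc)
        end_perm (cperm T)
          (end_comp (phiB (fc (eform (cupper T))))
             [seq (ear z, edeg z, f (fc (eform z))) | z <- clower T])
          ds xs.

End Algebras.

Record splitting (k : comPzRingType) (A : complex k) := Splitting {
  hgr : grading A;
  hgr_comm : forall p n x,
    gproj hgr p (gproj (cgr A) n x) = gproj (cgr A) n (gproj hgr p x);
  hgr_neg : forall p x, p < 0 -> gproj hgr p x = 0 }.

Record dcomplex (k : comPzRingType) := DComplex {
  dc_cx :> complex k;
  dc_sp : splitting dc_cx }.

Section Horizontal.
Variable k : comPzRingType.

Definition hproj (A : dcomplex k) (p : int) : {linear A -> A} :=
  gproj (hgr (dc_sp A)) p.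

(** The summand A_{p,q}. *)
Definition bihom (A : dcomplex k) (p q : int) (x : A) : Prop :=
  ghom (cgr A) (p + q) x /\ hproj A p x = x.

(** The submodule F_m A. *)
Definition filt (A : dcomplex k) (m : int) (x : A) : Prop :=
  forall p, m < p -> hproj A p x = 0.

Definition filtered_map (A B : dcomplex k) (r : nat) (g : seq A -> B) : Prop :=
  forall (ms : seq int) (xs : seq A), size ms = r -> size xs = r ->
    (forall i, (i < r)%N -> filt (nth 0 ms i) (nth 0 xs i)) ->
    filt (zsum ms) (g xs).

(** The part of a multilinear map which lowers the sum of the horizontal degrees
    by exactly [i]. *)
Definition hcomp (A B : dcomplex k) (i : int) (g : seq A -> B) (xs : seq A) : B :=
  \sum_(ps \in (fun ps : seq int => size ps = size xs))
    hproj B (zsum ps - i) (g [seq hproj A p.1 p.2 | p <- zip ps xs]).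

Definition dcomp (A : dcomplex k) (i : int) (x : A) : A :=
  hcomp i (fun xs => cd A (nth 0 xs 0)) [:: x].

Section Concentrated.
Variable A : complex k.

Definition conc_proj (p : int) : {linear A -> A} :=
  if p == 0 then (idfun : {linear A -> A}) else (\0 : {linear A -> A}).

Fact conc_proj_proj m n x :
  conc_proj m (conc_proj n x) = if m == n then conc_proj n x else 0.
Proof.
rewrite /conc_proj; case: (eqVneq n 0) => [->|n0].
  by case: (m == 0).
by case: (m == 0); rewrite /= if_same.
Qed.

Fact conc_proj_sum x : exists2 s : seq int, uniq s &
  x = \sum_(n <- s) conc_proj n x.
Proof. by exists [:: 0] => //; rewrite big_seq1. Qed.

Definition conc_grading : grading A := Grading conc_proj_proj conc_proj_sum.

Fact conc_comm p n x : gproj conc_grading p (gproj (cgr A) n x)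
  = gproj (cgr A) n (gproj conc_grading p x).
Proof. by rewrite /= /conc_proj; case: ifP => //= _; rewrite raddf0. Qed.

Fact conc_neg p x : p < 0 -> gproj conc_grading p x = 0.
Proof. by move=> p0; rewrite /= /conc_proj (lt_eqF p0). Qed.

Definition concentrated : dcomplex k := DComplex (Splitting conc_comm conc_neg).

End Concentrated.

(** In the spectral sequence of the filtration,
  E^r_p = Z^r_p / (Z^{r-1}_{p-1} + d Z^{r-1}_{p+r-1}); [n] is the total degree. *)
Definition Zpage (A : dcomplex k) (r p n : int) (x : A) : Prop :=
  [/\ ghom (cgr A) n x, filt p x & filt (p - r) (cd A x)].

Definition Bpage (A : dcomplex k) (r p n : int) (x : A) : Prop :=
  exists a b, [/\ Zpage (r - 1) (p - 1) n a, Zpage (r - 1) (p + r - 1) (n + 1) b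
                & x = a + cd A b].

(** The filtered chain map [g] induces a bijection on E^r. *)
Definition page_iso (A B : dcomplex k) (r : int) (g : A -> B) : Prop :=
  forall p n,
    (forall x : A, Zpage r p n x -> Bpage r p n (g x) -> Bpage r p n x) /\
    (forall y : B, Zpage r p n y ->
       exists2 x : A, Zpage r p n x & Bpage r p n (y - g x)).

End Horizontal.

Section Derived.
Variables (k : comPzRingType) (Q : quadratic_data k).
Local Notation E := (qE Q).

Record dhalg := DHAlg {
  dh_cx :> dcomplex k;
  dh_act : ftrees E -> seq dh_cx -> dh_cx;
  dh_hoalg : is_hoalg dh_act;
  dh_filt_d : forall m x, filt m x -> filt m (cd dh_cx x);
  dh_filt : forall r n xi, kdual Q r n xi -> filtered_map r (dh_act xi) }.

(** A differential graded O-algebra acts through kappa on the underlying complex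
    concentrated in horizontal degree 0. *)
Definition ga_hoact (A : dgalg Q) (xi : ftrees E) (xs : seq A) : A :=
  ga_act (kappa xi) xs.

Definition is_derived_infmor (At : dhalg) (A : dgalg Q)
    (f : ftrees E -> seq At -> concentrated A) : Prop :=
  is_infmor (dh_act (d := At)) (ga_hoact (A := A)) f /\
  forall r n xi, kdual Q r n xi -> filtered_map r (f xi).

Record derived_minimal_model (At : dhalg) (A : dgalg Q)
    (f : ftrees E -> seq At -> concentrated A) : Prop := {
  mm_infmor : is_derived_infmor f;
  mm_E2 : page_iso 2 (fun x => f (kunit Q) [:: x]);
  mm_minimal : forall x : At, dcomp 0 x = 0;
  mm_projective : forall p q, projective_on (@bihom k At p q) }.

Definition f1_0 (At : dhalg) (A : dgalg Q)
    (f : ftrees E -> seq At -> concentrated A) (y : At) : A :=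
  hcomp 0 (f (kunit Q)) [:: y].

Definition rho (At : dhalg) (A : dgalg Q)
    (f : ftrees E -> seq At -> concentrated A) (y : At) : homology A :=
  hclass (f1_0 f y).

(** The list x_1, ..., x_{i-1}, y, x_{i+1}, ..., x_r *)
Definition replace (V : Type) (r : nat) (x : 'I_r -> V) (i : 'I_r) (y : V)
  : seq V := [seq (if j == i then y else x j) | j <- enum 'I_r].

Definition beta (r : nat) (m : int) (deg : 'I_r -> int) (i : 'I_r) : int :=
  m + \sum_(j < r | (j < i)%N) deg j.

(** Graph of the operation induced on homology: [h] is the value of [mu] on the
    homology classes [xs], which have degrees [ds]. *)
Definition hact (A : dgalg Q) (r : nat) (m : int) (mu : E r m)
    (ds : seq int) (xs : seq (homology A)) (h : homology A) : Prop :=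
  exists2 ys : seq A,
    homs ds ys /\ List.Forall2 (@represents k A) ys xs
    & h = hclass (ga_act (generator mu) ys).

(** The torsion Massey product as a coset in homology, where [deg i] is the
    degree of [x i]. *)
Definition massey (A : dgalg Q) (r : nat) (m : int) (mu : E r m)
    (deg : 'I_r -> int) (x : 'I_r -> homology A) (t : 'I_r -> k)
    (h : homology A) : Prop :=
  exists (y z : 'I_r -> A) (g h' : 'I_r -> homology A),
  [/\ forall i, ghom (cgr A) (deg i) (y i) /\ represents (y i) (x i),
      forall i, ghom (cgr A) (deg i + 1) (z i) /\ cd A (z i) = t i *: y i,
      forall i, hdeg (deg i + 1) (g i),
      forall i, hact mu (replace deg i (deg i + 1)) (replace x i (g i)) (h' i)
    & h = hclass (\sum_(i < r) ksgn k (beta m deg i) *: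
                    ga_act (generator mu) (replace y i (z i)))
          + \sum_(i < r) h' i].

End Derived.

(* Main.v *)
From HB Require Import structures.
Require Import Defs.
From mathcomp Require Import all_boot all_order all_algebra all_fingroup.
From mathcomp Require Import boolp classical_sets fsbigop.
From mathcomp Require Import zify.
Import Order.TTheory GRing.Theory Num.Theory.
Local Open Scope ring_scope.

Set Implicit Arguments.
Unset Strict Implicit.
Unset Printing Implicit Defensive.

(** The infinity-morphism itself produces the data of the Massey product: take
  y_i = f(1)(u_i) and z_i = f(1)(v_i).  As the horizontal resolution is minimal,
  d(v_i) = t_i u_i, and f(1) is a chain map, so d(z_i) = t_i y_i.  The equation
  of an infinity-morphism on s mu, applied to (u_1, ..., v_i, ..., u_r), reads
    d f(s mu)(.., v_i, ..) + (-1)^beta_i t_i f(s mu)(u_1, ..., u_r)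
      = f(1)((s mu)(.., v_i, ..)) - mu(.., z_i, ..)
  ([infmor_susp], [massey_term]).  Multiply by (-1)^beta_i and sum over i: the
  terms t_i f(s mu)(u_1, ..., u_r) cancel because the t_i add up to 0, so that up
  to a boundary the Massey cycle is the signed sum of the
  f(1)((s mu)(.., v_i, ..)).  By filtration (s mu)(.., v_i, ..) has only two
  horizontal components, (s mu)_0 and (s mu)_1 ([susp_components]).  The signed
  sum of the former is d_1(w) = d(w) - d_2(w), which f(1) maps to -f(1)(d_2(w))
  modulo boundaries; the latter lie in horizontal degree 0, where f(1) is f(1)_0
  and hence induces rho.

  The equations of homotopy algebras and infinity-morphisms can be applied to
  1 and s mu only once both are known to lie in the Koszul dual cooperad and their
  decompositions are written down.  The former holds because I + sE is a
  subcooperad with zero weight 2 part ([low_subcooperad], [low_kdual]); the latter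
  is [low_terms_decompose], [unit_idecomposes] and [susp_idecomposes].  That
  the algebra A acts by kappa(s mu) = mu and kappa(1) = 0 requires
  kappa to be well defined on classes of formal sums ([kappa_fc]). *)

(** * Lists *)

Lemma size_take_drop (T : Type) (xs : seq T) i : (i < size xs)%N ->
  (size (take i xs) + size (drop i.+1 xs)).+1 = size xs.
Proof.
move=> hi; rewrite size_take hi size_drop -addnS -subSn // subSS subnKC //.
exact: ltnW.
Qed.

Lemma Forall_map_in (T : eqType) (V : Type) (P : V -> Prop) (h : T -> V) s :
  (forall i, i \in s -> P (h i)) -> List.Forall P (map h s).
Proof.
elim: s => //= i s IH hs; constructor; first exact/hs/mem_head.
by apply: IH => j hj; apply: hs; rewrite inE hj orbT.
Qed.

(** * Koszul signs *)

Section Signs.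
Variable k : comPzRingType.

Lemma ksgn0 : ksgn k 0 = 1. Proof. exact: expr0. Qed.

Lemma ksgnD a b : ksgn k (a + b) = ksgn k a * ksgn k b.
Proof.
rewrite /ksgn -exprD -signr_odd -[RHS]signr_odd; congr (_ ^+ (nat_of_bool _)).
rewrite oddD; case: a b => [a|a] [b|b].
- by rewrite -PoszD !absz_nat oddD.
- rewrite NegzE abszN !absz_nat; case: (leqP b.+1 a) => h.
    by rewrite subzn // absz_nat oddB.
  by rewrite -opprB subzn ?(ltnW h) // abszN absz_nat oddB ?(ltnW h) // addbC.
- rewrite NegzE abszN !absz_nat addrC; case: (leqP a.+1 b) => h.
    by rewrite subzn // absz_nat oddB // addbC.
  by rewrite -opprB subzn ?(ltnW h) // abszN absz_nat oddB ?(ltnW h).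
- by rewrite !NegzE -opprD -PoszD !abszN !absz_nat oddD.
Qed.

Lemma ksgnD1 a : ksgn k (a + 1) = - ksgn k a.
Proof. by rewrite ksgnD /ksgn expr1 mulrN1. Qed.

Lemma ksgnK a : ksgn k a * ksgn k a = 1.
Proof. by rewrite /ksgn -expr2 sqrr_sign. Qed.

Lemma zsum_cons n s : zsum (n :: s) = n + zsum s.
Proof. exact: big_cons. Qed.

Lemma zsum_nil : zsum [::] = 0. Proof. exact: big_nil. Qed.

Lemma zsum_eq0 s : all (eq_op 0) s -> zsum s = 0.
Proof. by move=> h; rewrite /zsum big1_seq // => i /= /(allP h) /eqP. Qed.

Lemma kexp_iota ds off n : kexp ds (iota off n) = 0.
Proof.
elim: n off => //= n IH off; rewrite IH addr0 big1_seq // => b /andP[ba].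
by rewrite mem_iota ltnNge (ltnW ba).
Qed.

Lemma kexp_eq0 ds s : all (eq_op 0) ds -> kexp ds s = 0.
Proof.
move=> h; have n0 a : nth 0 ds a = 0.
  case: (ltnP a (size ds)) => ha; last exact: nth_default.
  by apply/esym/eqP/(allP h)/mem_nth.
elim: s => //= a s ->; rewrite big1 ?addr0 // => b _.
by rewrite n0 mul0r.
Qed.

End Signs.

(** * Formal sums of trees and their classes *)

Section FormalSums.
Variables (k : comPzRingType) (E : smodule k).
Local Notation tree := (tree E).
Local Notation fsum := (fsum k tree).
Implicit Types (t : tree) (x y : fsum) (ts us : seq tree).

Section Classes.
Variable RR : nat -> fsum -> Prop.

Lemma tcls_cat x y : tcls RR (x ++ y) = tcls RR x + tcls RR y.
Proof. by rewrite /tcls /fcls; apply/esym/pq_addE. Qed.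

Lemma tcls_scale c x : tcls RR (fscale c x) = c *: tcls RR x.
Proof. by rewrite /tcls /fcls; apply/esym/pq_scaleE. Qed.

Lemma tcls_sum x : tcls RR x = \sum_(p <- x) tcls RR [:: p].
Proof.
elim: x => [|p x IH]; first by rewrite big_nil.
by rewrite big_cons -IH -tcls_cat.
Qed.

Lemma tcls_single c t : tcls RR [:: (c, t)] = c *: tcls RR (tone t).
Proof. by rewrite -tcls_scale /fscale /= mulr1. Qed.

Lemma tcls_feval x : tcls RR x = feval (fun t => tcls RR (tone t)) x.
Proof.
by rewrite tcls_sum; apply: eq_bigr => -[c t] _; rewrite tcls_single.
Qed.

Lemma tcls_flatten (I : Type) (F : I -> fsum) (s : seq I) :
  tcls RR (flatten (map F s)) = \sum_(i <- s) tcls RR (F i).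
Proof.
elim: s => [|i s IH]; first by rewrite big_nil.
by rewrite big_cons -IH -tcls_cat.
Qed.

Lemma tcls_rel x : trel RR x -> tcls RR x = 0.
Proof.
move=> h; apply/pclsP => M F hF; rewrite hF // /feval.
exact/esym/big_nil.
Qed.

Lemma feval_frepr (M : lmodType k) (F : tree -> M) x :
  (forall z, trel RR z -> feval F z = 0) ->
  feval F (frepr (tcls RR x)) = feval F x.
Proof.
by move=> hF; apply: (preprE (P := pres_pm (trel RR)) x).
Qed.

End Classes.

Lemma fscale1 x : fscale 1 x = x.
Proof. by rewrite /fscale -[RHS]map_id; apply: eq_map => -[c t]; rewrite mul1r. Qed.

Lemma fbind_single h c t : fbind h [:: (c, t)] = fscale c (h t).
Proof. exact: cats0. Qed.

Lemma fbind_tone h t : fbind h (tone t) = h t.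
Proof. by rewrite fbind_single fscale1. Qed.

Lemma fchoices_tone ts : fchoices (map (@tone k E) ts) = [:: (1, ts)].
Proof. by elim: ts => //= t ts ->; rewrite /allpairs /= mul1r. Qed.

Lemma fgraft_tone us x :
  fgraft (map (@tone k E) us) x
    = [seq (ksgn k (graft_exp us p.2) * p.1, graft us p.2) | p <- x].
Proof.
rewrite /fgraft fchoices_tone; elim: x => //= p x <-.
by rewrite mulr1.
Qed.

(** Moving elements of degree 0 past the vertices produces no sign. *)
Lemma graft_exp0 us t : all (fun u => tdeg u == 0) us -> graft_exp us t = 0.
Proof.
move=> h; rewrite /graft_exp.
have n0 a : nth 0 (map (@tdeg k E) us) a = 0.
  case: (ltnP a (size us)) => ha; last by rewrite nth_default ?size_map.
  by rewrite (nth_map t) //; apply/eqP; exact: (all_nthP t h).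
by elim: (tword t) => //= -[d|a] w // ->; rewrite n0 mul0r.
Qed.

Lemma graft_leaves us r : size us = r ->
  [seq graft us t | t <- [seq Leaf a | a <- iota 0 r]] = us.
Proof.
move=> <-; rewrite -map_comp.
rewrite -[RHS]take_size -(map_nth_iota0 (Leaf 0) (leqnn (size us))).
apply/eq_in_map => a; rewrite mem_iota /= => ha; exact: set_nth_default.
Qed.

Lemma fgraft_corolla c b r n (e : E r n) us :
  size us = r -> all (fun u => tdeg u == 0) us ->
  fgraft (map (@tone k E) us) [:: (c, corolla b e)] = [:: (c, Node b e us)].
Proof.
move=> sz us0; rewrite fgraft_tone /= graft_exp0 // ksgn0 mul1r.
by rewrite graft_leaves.
Qed.

Lemma fgraft_root c t : fgraft [:: [:: (c, t)]] (tone (Leaf 0)) = [:: (c, t)].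
Proof.
rewrite /fgraft /= /graft_exp /= zsum_nil mulr0 addr0 ksgn0.
by rewrite !mulr1 !mul1r.
Qed.

End FormalSums.

(** * The part I + sE of the Koszul dual cooperad *)

Section LowWeights.
Variables (k : comPzRingType) (Q : quadratic_data k).
Local Notation E := (qE Q).
Local Notation tree := (tree E).
Local Notation fsum := (fsum k tree).

(** The leaves are listed with their labels, so that a corolla may be followed by
    a permutation. *)
Inductive low_tree : nat -> int -> tree -> Prop :=
| low_leaf : low_tree 1 0 (Leaf 0)
| low_node r m (e : E r m) s :
    permlist r s -> low_tree r (m + 1) (Node true e (map Leaf s)).

Definition low_weight (r : nat) (n : int) (xi : ftrees E) : Prop :=
  exists2 x : fsum, List.Forall (fun p => low_tree r n p.2) x & fc x = xi.

Lemma permlist_size r s : permlist r s -> size s = r.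
Proof. by move/perm_size; rewrite size_iota. Qed.

Lemma permlist_iota r : permlist r (iota 0 r). Proof. exact: perm_refl. Qed.

Lemma permlist_lt r s a : permlist r s -> a \in s -> (a < r)%N.
Proof. by move/perm_mem ->; rewrite mem_iota. Qed.

Lemma permlist_comp r s s' : permlist r s -> permlist r s' ->
  permlist r [seq nth 0%N s' a | a <- s].
Proof.
move=> hs hs'; rewrite /permlist; apply: perm_trans (hs').
have {2}-> : s' = [seq nth 0%N s' a | a <- iota 0 r].
  by rewrite -(permlist_size hs') map_nth_iota0 // take_size.
exact: perm_map.
Qed.

Lemma flatten_leaves s : flatten (map (@leaves k E) (map Leaf s)) = s.
Proof. by elim: s => //= a s ->. Qed.

Lemma leaves_corolla b r m (e : E r m) : leaves (corolla b e) = iota 0 r.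
Proof. exact: flatten_leaves. Qed.

Lemma zsum_tdeg_leaves (h : nat -> tree) s :
  (forall a, tdeg (h a) = 0) -> zsum (map (@tdeg k E) (map h s)) = 0.
Proof.
by move=> h0; elim: s => [|a s IH]; rewrite ?zsum_nil //= zsum_cons IH h0.
Qed.

Lemma node_fhom b r m (e : E r m) s c :
  permlist r s -> fhom b r (m + (b : nat)%:Z) [:: (c, Node b e (map Leaf s))].
Proof.
move=> hs; rewrite /fhom /= flatten_leaves hs zsum_tdeg_leaves // addr0.
rewrite size_map (permlist_size hs) !eqxx /= !andbT.
by apply/andP; split; elim: s {hs}.
Qed.

Lemma low_tree_fhom r n t c : low_tree r n t -> fhom true r n [:: (c, t)].
Proof. by case=> // *; apply: node_fhom. Qed.

Lemma Forall_low_tree_fhom r n (x : fsum) :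
  List.Forall (fun p => low_tree r n p.2) x -> fhom true r n x.
Proof.
elim=> // -[c t] y /= h _ IH; have := low_tree_fhom c h.
by rewrite /fhom /= andbT => ->.
Qed.

Lemma relabel_node g b r m (e : E r m) s :
  relabel g (Node b e (map Leaf s)) = Node b e (map Leaf (map g s)).
Proof. by rewrite /= -!map_comp. Qed.

Lemma low_tree_relabel r n t s :
  low_tree r n t -> permlist r s -> low_tree r n (relabel (nth 0%N s) t).
Proof.
case=> [hs|{}r m e s' hs' hs].
  case: s hs => [|a [|b s]] hs; try by have := permlist_size hs.
  by have := permlist_lt hs (mem_head _ _); case: a {hs} => //= _; apply: low_leaf.
by rewrite relabel_node; apply/low_node/permlist_comp.
Qed.

Lemma relabel_id g : forall t : tree,
  {in leaves t, forall a, g a = a} -> relabel g t = t.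
Proof.
fix IH 1; case=> [a|t|b r n e ts] /= h; first by rewrite h ?mem_head.
  by rewrite IH.
congr Node; elim: ts h => //= t ts IHts h.
rewrite IH ?IHts // => a ha; apply: h; rewrite mem_cat ha ?orbT //.
Qed.

Lemma low_tree_leaves r n t : low_tree r n t -> {in leaves t, forall a, (a < r)%N}.
Proof.
case=> [a|{}r m e s hs a]; first by rewrite inE => /eqP ->.
by rewrite /= flatten_leaves; apply: permlist_lt.
Qed.

Lemma nth_iota_id r a : (a < r)%N -> nth 0%N (iota 0 r) a = a.
Proof. by move=> h; rewrite nth_iota. Qed.

Lemma tdeg_relabel g : forall t : tree, tdeg (relabel g t) = tdeg t.
Proof.
fix IH 1; case=> //= b r n e ts; congr (_ + _ + _).
by elim: ts => //= t ts IHts; rewrite !zsum_cons IHts IH.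
Qed.

Lemma invlist_lt r (sigma : 'S_r) i : i \in invlist sigma -> (i < r)%N.
Proof. by case/mapP => j _ ->. Qed.

(** Relabelling the leaves respects the relations, since these only involve the
    decorations. *)
Lemma trel_relabel g (z : fsum) : trel (@noRR k E) z -> trel (@noRR k E) (frelabel g z).
Proof.
elim=> {z} [b r n c e e' ts sz|b r n sigma e ts sz|//|b r n e ts1 ts2 x sz _ IH|x _ IH].
- by apply: trel_lin; rewrite size_map.
- rewrite /frelabel /fmap /=.
  have -> : map (relabel g) [seq nth (Leaf 0) ts i | i <- invlist sigma]
      = [seq nth (Leaf 0) (map (relabel g) ts) i | i <- invlist sigma].
    rewrite -map_comp; apply/eq_in_map => i /invlist_lt h /=.
    by rewrite (nth_map (Leaf 0)) // sz.
  have -> : map (@tdeg k E) ts = map (@tdeg k E) (map (relabel g) ts).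
    by rewrite -map_comp; apply: eq_map => t /=; rewrite tdeg_relabel.
  by apply: trel_perm; rewrite size_map.
- have -> : frelabel g (fmap (fun t => Node b e (ts1 ++ t :: ts2)) x)
    = fmap (fun t => Node b e (map (relabel g) ts1 ++ t :: map (relabel g) ts2))
        (frelabel g x).
    by rewrite /frelabel /fmap -!map_comp; apply: eq_map => p /=; rewrite map_cat.
  by apply: trel_node => //; rewrite !size_map.
- have -> : frelabel g (fmap (@Cut k E) x) = fmap (@Cut k E) (frelabel g x).
    by rewrite /frelabel /fmap -!map_comp.
  exact: trel_cut.
Qed.

Lemma feval_fmap (M : lmodType k) (F : tree -> M) h (x : fsum) :
  feval F (fmap h x) = feval (F \o h) x.
Proof. by rewrite /feval big_map. Qed.

Lemma fc_relabel g (x y : fsum) : fc x = fc y -> fc (frelabel g x) = fc (frelabel g y).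
Proof.
move=> e; rewrite /fc [LHS]tcls_feval [RHS]tcls_feval !feval_fmap.
have hF z : trel (@noRR k E) z ->
    feval ((fun t => tcls (@noRR k E) (tone t)) \o relabel g) z = 0.
  by move=> /(trel_relabel g)/tcls_rel; rewrite tcls_feval feval_fmap.
by rewrite -(feval_frepr x hF) -[RHS](feval_frepr y hF) [tcls _ x]e.
Qed.

Lemma low_smodule : sub_smodule true low_weight.
Proof.
split=> [r n xi [x hx e]|r n|r n c _ _ [x hx <-] [y hy <-]|r n x s _ hs [y hy e]].
- by exists x => //; apply: Forall_low_tree_fhom.
- by exists [::].
- exists (fscale c x ++ y); last by rewrite /fc tcls_cat tcls_scale.
  apply/List.Forall_app; split=> //.
  by elim: hx => [|p z hp _ IH]; constructor.
- exists (fperm s y).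
    by elim: hy => [|p z hp _ IH]; constructor => //; apply: low_tree_relabel.
  exact: fc_relabel.
Qed.

Definition unit_elt : elt Q := Elt 1 0 (tone (Leaf 0)).

(** The trivial tree is cut in one way only; a corolla is cut at the root or at
    all its leaves.  In the second term the labels of the leaves are the permutation
    acting on the standard corolla. *)
Definition low_terms (r : nat) (n : int) (p : k * tree) : seq (cterm Q) :=
  CTerm unit_elt [:: Elt r n [:: p]] (iota 0 r) ::
  if p.2 is Node b r' n' e ts then
    [:: CTerm (Elt r n [:: (p.1, corolla b e)]) (nseq r unit_elt) (leaves p.2)]
  else [::].

Definition cterm_sum (L : seq (cterm Q)) : ftrees E :=
  \sum_(T <- L)
    fc (fperm (cperm T)
         (fcomp (eform (cupper T))
            [seq (ear z, fmap (@Cut k E) (eform z)) | z <- clower T])).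

Lemma relabel_add0 (t : tree) : relabel (addn 0) t = t.
Proof. exact: relabel_id. Qed.

Lemma fcomp_unit r c t :
  fcomp (tone (Leaf 0)) [:: (r, [:: (c, t)])] = [:: (c, t)] :> fsum.
Proof. by rewrite /fcomp /= relabel_add0 fgraft_root. Qed.

Lemma fshift_nseq off r t :
  fshift off (nseq r (1%N, tone t))
    = map (@tone k E) [seq relabel (addn a) t | a <- iota off r].
Proof. by elim: r off => //= r IH off; rewrite IH addn1. Qed.

Lemma fcomp_cut_leaves b r m (e : E r m) c :
  fcomp [:: (c, corolla b e)] (nseq r (1%N, tone (Cut (Leaf 0))))
    = [:: (c, Node b e [seq Cut (Leaf a) | a <- iota 0 r])].
Proof.
rewrite /fcomp fshift_nseq fgraft_corolla ?size_map ?size_iota //; last first.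
  by elim: (iota 0 r).
congr [:: (_, Node _ _ _)]; by apply: eq_map => a /=; rewrite addn0.
Qed.

Lemma decomp_node b r m (e : E r m) s :
  decomp (Node b e (map Leaf s))
    = [:: (1, Cut (Node b e (map Leaf s)));
          (1, Node b e [seq Cut (Leaf a) | a <- s])].
Proof.
rewrite /= -map_comp (_ : map _ s = map (@tone k E) [seq Cut (Leaf a) | a <- s]).
  by rewrite fchoices_tone.
by rewrite -map_comp.
Qed.

Lemma fperm_node s b r m (e : E r m) c : size s = r ->
  fperm s [:: (c, Node b e [seq Cut (Leaf a) | a <- iota 0 r])]
    = [:: (c, Node b e [seq Cut (Leaf a) | a <- s])] :> fsum.
Proof.
move=> sz; rewrite /fperm /frelabel /fmap /= -map_comp.
congr [:: (_, Node _ _ _)].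
rewrite -[in RHS](take_size s) -(map_nth_iota0 0%N (leqnn _)) -map_comp sz.
by apply: eq_map.
Qed.

Lemma fperm_cut_low_tree r n c t : low_tree r n t ->
  fperm (iota 0 r) [:: (c, Cut t)] = [:: (c, Cut t)] :> fsum.
Proof.
move=> h; rewrite /fperm /frelabel /fmap /=.
by rewrite relabel_id // => a /(low_tree_leaves h); apply: nth_iota_id.
Qed.

Lemma low_terms_sum r n c t : low_tree r n t ->
  fc (fbind (@decomp k Q) [:: (c, t)]) = cterm_sum (low_terms r n (c, t)).
Proof.
move=> h; rewrite /cterm_sum big_cons.
rewrite -[X in _ = X + _]/(fc (fperm (iota 0 r)
  (fcomp (tone (Leaf 0)) [:: (r, [:: (c, Cut t)])]))).
rewrite fcomp_unit (fperm_cut_low_tree _ h).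
rewrite fbind_single; case: h => [|{}r m e s hs].
  by rewrite big_nil addr0 /fscale /= mulr1.
rewrite decomp_node big_seq1 /= map_nseq flatten_leaves.
rewrite fcomp_cut_leaves fperm_node ?(permlist_size hs) //.
by rewrite /fc -tcls_cat /fscale /= !mulr1.
Qed.

Lemma sumn_nseq1 r : sumn (nseq r 1%N) = r.
Proof. by rewrite sumn_nseq mul1n. Qed.

Lemma zsum_nseq0 r : zsum (nseq r 0) = 0.
Proof. by rewrite zsum_eq0 // all_nseq eqxx orbT. Qed.

Lemma low_weight_tree r n p : low_tree r n p.2 -> low_weight r n (fc [:: p]).
Proof. by move=> h; exists [:: p] => //; constructor. Qed.

Lemma low_tree_elt r n c t : low_tree r n t -> elt_in low_weight (Elt r n [:: (c, t)]).
Proof. by move=> h; split; [exact: low_tree_fhom h | apply: low_weight_tree]. Qed.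

Lemma unit_elt_in : elt_in low_weight unit_elt.
Proof. exact/low_tree_elt/low_leaf. Qed.

Lemma low_terms_in r n c t : low_tree r n t ->
  List.Forall (fun T : cterm Q =>
    let y := cupper T in let zs := clower T in
    [/\ elt_in low_weight y /\ List.Forall (elt_in low_weight) zs, ear y = size zs,
        sumn (map (@ear k Q) zs) = r, edeg y + zsum (map (@edeg k Q) zs) = n
      & permlist r (cperm T)]) (low_terms r n (c, t)).
Proof.
move=> h; constructor => /=.
  split=> //; rewrite ?addn0 ?zsum_cons ?zsum_nil ?addr0 ?add0r //.
    split; first exact: unit_elt_in.
    by constructor => //; apply: low_tree_elt.
  exact: permlist_iota.
case: h => [|{}r m e s hs]; constructor => //=; split=> //.
- split; first exact/low_tree_elt/low_node/permlist_iota.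
  by elim: r {e hs} => //= r IH; constructor => //; exact: unit_elt_in.
- by rewrite size_nseq.
- by rewrite map_nseq sumn_nseq1.
- by rewrite map_nseq zsum_nseq0 addr0.
- by rewrite flatten_leaves.
Qed.

Lemma low_decomposes r n (x : fsum) :
  List.Forall (fun p => low_tree r n p.2) x ->
  decomposes low_weight r n x (flatten (map (low_terms r n) x)).
Proof.
elim=> [|[c t] y h _ [IH1 IH2]].
  by split; [constructor | rewrite big_nil].
rewrite -[flatten _]/(low_terms r n (c, t) ++ flatten (map (low_terms r n) y)).
split.
  apply: (proj2 (List.Forall_app _ (low_terms r n (c, t)) _)); split=> //.
  exact: low_terms_in.
rewrite big_cat /= -IH2 -[X in _ = X + _](low_terms_sum c h).
by rewrite /fc -tcls_cat fbind_single.
Qed.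

Lemma low_subcooperad : subcooperad low_weight.
Proof.
split; first exact: low_smodule.
move=> r n xi [x hx e]; exists x, (flatten (map (low_terms r n) x)).
by split=> //; [exact: Forall_low_tree_fhom | exact: low_decomposes].
Qed.

Lemma low_tree_weight r n t : low_tree r n t -> (weight t == 2) = false.
Proof.
case=> [|{}r m e s _] //=.
by have -> : sumn (map (@weight k E) (map Leaf s)) = 0%N by elim: s.
Qed.

Lemma low_weight2 : weight2_in_s2R low_weight.
Proof.
move=> r n xi [x hx e]; exists x; split=> //; first exact: Forall_low_tree_fhom.
have -> : [seq p <- x | weight p.2 == 2] = [::].
  by elim: hx => //= p y /low_tree_weight -> _.
exists [::]; split=> //.
by have [_ h _ _] := qR_sub Q; apply: h.
Qed.

(** The Koszul dual is the largest subcooperad with weight 2 part in s^2R, and the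
    weight 2 part of I + sE vanishes. *)
Lemma low_kdual r n xi : low_weight r n xi -> kdual Q r n xi.
Proof.
by exists low_weight; split=> //; [exact: low_subcooperad | exact: low_weight2].
Qed.

Lemma elt_low_kdual y : elt_in low_weight y -> elt_in (kdual Q) y.
Proof. by case=> h /low_kdual. Qed.

Lemma low_tree_corolla r m (mu : E r m) : low_tree r (m + 1) (corolla true mu).
Proof. exact/low_node/permlist_iota. Qed.

Lemma kdual_susp r m (mu : E r m) : kdual Q r (m + 1) (susp mu).
Proof. exact/low_kdual/low_weight_tree/low_tree_corolla. Qed.

Lemma kdual_unit : kdual Q 1 0 (kunit Q).
Proof. exact/low_kdual/low_weight_tree/low_leaf. Qed.

Lemma low_terms_decompose r n t : low_tree r n t ->
  decomposes (kdual Q) r n (tone t) (low_terms r n (1, t)).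
Proof.
move=> h; split; last exact: low_terms_sum.
apply: List.Forall_impl (low_terms_in 1 h) => T /= [[hy hz] ? ? ? ?].
split=> //; split; first exact: elt_low_kdual.
by apply: List.Forall_impl hz => z; apply: elt_low_kdual.
Qed.

Lemma fpcomp_leaf b r m (e : E r m) i : (i < r)%N ->
  fpcomp r i 1 (tone (corolla b e)) (tone (Cut (Leaf 0)))
    = tone (Node b e (take i (map Leaf (iota 0 r)) ++ Cut (Leaf i)
                        :: drop i.+1 (map Leaf (iota 0 r)))).
Proof.
move=> hi; rewrite /fpcomp -!map_take -!map_drop take_iota drop_iota.
rewrite (minn_idPl (ltnW hi)) add0n.
set us := _ ++ Cut _ :: _.
rewrite (_ : _ ++ _ = map (@tone k E) us); last first.
  by rewrite /us map_cat -!map_comp /= -map_comp addn0 addn1.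
apply: fgraft_corolla; rewrite /us.
  by rewrite size_cat /= !size_map !size_iota addnS -addSn subnKC.
by rewrite all_cat /= !all_map; apply/andP; split; apply/allP.
Qed.

Lemma fpcomp_unit c r t :
  fpcomp 1 0 r (tone (Leaf 0)) [:: (c, t)] = [:: (c, t)] :> fsum.
Proof. by rewrite /fpcomp /= relabel_add0 fgraft_root. Qed.

Lemma unit_idecomposes :
  idecomposes (kdual Q) 1 0 (tone (Leaf 0)) [:: ITerm unit_elt 0 unit_elt [:: 0%N]].
Proof.
have hu := elt_low_kdual unit_elt_in.
split; first by constructor.
rewrite big_seq1 fbind_tone.
by rewrite -[X in fperm _ X]/(fpcomp 1 0 1 (tone (Leaf 0)) [:: (1, Cut (Leaf 0))])
  fpcomp_unit.
Qed.

Definition susp_iterms r m (mu : E r m) : seq (iterm Q) :=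
  let c := Elt r (m + 1) (tone (corolla true mu)) in
  ITerm unit_elt 0 c (iota 0 r) :: [seq ITerm c i unit_elt (iota 0 r) | i <- iota 0 r].

Lemma susp_idecomposes r m (mu : E r m) :
  idecomposes (kdual Q) r (m + 1) (tone (corolla true mu)) (susp_iterms mu).
Proof.
have hu := elt_low_kdual unit_elt_in.
have hm : elt_in (kdual Q) (Elt r (m + 1) (tone (corolla true mu))).
  by apply/elt_low_kdual/low_tree_elt/low_tree_corolla.
split.
  constructor; first by split=> //=; rewrite ?add1n ?add0r //; exact: permlist_iota.
  apply: Forall_map_in => i; rewrite mem_iota /= => hi.
  by split=> //; rewrite ?addn1 ?addr0 //; exact: permlist_iota.
rewrite fbind_tone /susp_iterms big_cons.
rewrite -[X in _ = X + _]/(fc (fperm (iota 0 r)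
  (fpcomp 1 0 r (tone (Leaf 0)) [:: (1, Cut (corolla true mu))]))).
rewrite fpcomp_unit (fperm_cut_low_tree _ (low_tree_corolla mu)).
rewrite /fc tcls_cat; congr (_ + _); rewrite big_map size_map size_iota.
pose plug i T := Node true mu
  (take i (map Leaf (iota 0 r)) ++ T :: drop i.+1 (map Leaf (iota 0 r))).
have cut_leaf i : (i < r)%N ->
    fperm (iota 0 r) (fpcomp r i 1 (tone (corolla true mu)) (tone (Cut (Leaf 0))))
    = fmap (plug i) (tone (Cut (Leaf i))).
  move=> hi; rewrite fpcomp_leaf //; congr [:: (_, _)]; apply: relabel_id => a h.
  apply: nth_iota_id; move: h; rewrite -[Node _ _ _]/(plug i (Cut (Leaf i))).
  have -> : leaves (plug i (Cut (Leaf i))) = leaves (corolla true mu).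
    rewrite /= -[in RHS](cat_take_drop i (map Leaf _)) (@drop_nth _ (Leaf 0) i).
      by rewrite !map_cat (nth_map 0%N) ?size_iota // nth_iota.
    by rewrite size_map size_iota.
  by rewrite leaves_corolla mem_iota.
transitivity (fc (flatten [seq fmap (plug i) (tone (Cut (Leaf i))) | i <- iota 0 r])).
  congr (fc (flatten _)); apply/eq_in_map => i; rewrite mem_iota /= => h.
  rewrite (nth_map (Leaf 0)) ?size_map ?size_iota //.
  by rewrite (nth_map 0%N) ?size_iota // nth_iota.
rewrite /fc tcls_flatten; apply: eq_big_seq => i; rewrite mem_iota /= => h.
by rewrite cut_leaf.
Qed.

End LowWeights.

(** * The twisting morphism *)

Section Kappa.
Variables (k : comPzRingType) (Q : quadratic_data k).
Local Notation E := (qE Q).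
Local Notation tree := (tree E).
Local Notation fsum := (fsum k tree).

Lemma permlist_invlist r (sigma : 'S_r) : permlist r (invlist sigma).
Proof.
rewrite /permlist /invlist -val_enum_ord (map_comp val (perm_inv sigma)).
apply: perm_map; apply: uniq_perm; rewrite ?enum_uniq //.
  by rewrite map_inj_uniq ?enum_uniq //; exact: perm_inj.
move=> i; rewrite mem_enum; apply/mapP; exists (sigma i); rewrite ?mem_enum //.
by rewrite permK.
Qed.

Lemma all_permlist (T : Type) (x0 : T) P (ts : seq T) s :
  permlist (size ts) s -> all P [seq nth x0 ts i | i <- s] = all P ts.
Proof.
by move=> hs; rewrite -[in RHS](mkseq_nth x0 ts) /mkseq !all_map (perm_all _ hs).
Qed.

Lemma sumn_permlist (T : Type) (x0 : T) (h : T -> nat) (ts : seq T) s :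
  permlist (size ts) s -> sumn (map h [seq nth x0 ts i | i <- s]) = sumn (map h ts).
Proof.
move=> hs; rewrite -[in RHS](mkseq_nth x0 ts) /mkseq -!map_comp.
exact/perm_sumn/perm_map.
Qed.

Lemma weight0_leaves (ts : seq tree) :
  all (tpure true) ts -> sumn (map (@weight k E) ts) = 0%N ->
  exists s, ts = map Leaf s.
Proof.
elim: ts => [|[a|t|b r n e us] ts IH] //=; first by exists [::].
by move=> h /(IH h) [s ->]; exists (a :: s).
Qed.

(** The branches of a tree of weight 1 without cuts are leaves, so no relator can
    be applied inside a branch: relators have a vertex or a cut in every tree. *)
Lemma trel_not_leaf z : trel (@noRR k E) z ->
  all (fun p => ~~ (tpure true p.2 && (weight p.2 == 0))) z.
Proof.
case=> {z} [b r n c e e' ts _|b r n sigma e ts _|//|b r n e ts1 ts2 x _ _|x _] /=;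
  rewrite ?andbF //.
- by elim: x => //= p x ->; rewrite andbF.
- by elim: x => //= p x ->.
Qed.

Definition kappa_tree (t : tree) : otrees Q :=
  if tpure true t && (weight t == 1)
  then oc Q (tone (setflag false t)) else 0.

(** In weight 1 the branches are leaves, so the relators are multilinearity and
    equivariance at a single vertex; they hold again after removing the
    suspension because permuting leaves, which have degree 0, produces no sign. *)
Lemma kappa_tree_rel z : trel (@noRR k E) z -> feval kappa_tree z = 0.
Proof.
case=> {z} [b r n c e e' ts sz|b r n sigma e ts sz|//|b r n e ts1 ts2 x sz hx|x _].
- rewrite /feval 2!big_cons big_seq1 /kappa_tree /=; case: ifP => _; last first.
    by rewrite !scaler0 !addr0.
  have sz' : size (map (setflag false) ts) = r by rewrite size_map.
  have := tcls_rel (trel_lin (@qRR k Q) false c e e' sz').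
  by rewrite tcls_feval /feval 2!big_cons big_seq1.
- have hs := permlist_invlist sigma; rewrite -{1}sz in hs.
  rewrite /feval big_cons big_seq1 /kappa_tree /= all_permlist // sumn_permlist //.
  case: ifP => [/andP[/andP[_ pu] /eqP [w0]]|_]; last by rewrite !scaler0 !addr0.
  have [s es] := weight0_leaves pu w0.
  have sz' : size (map (setflag false) ts) = r by rewrite size_map.
  have := tcls_rel (trel_perm (@qRR k Q) false sigma e sz').
  rewrite tcls_feval /feval big_cons big_seq1.
  have d0 us : us = map (@tdeg k E) ts \/ us = map (@tdeg k E) (map (setflag false) ts)
     -> kexp us (invlist sigma) = 0.
    by case=> ->; apply: kexp_eq0; rewrite es; elim: (s) => //= a l ->.
  rewrite (d0 _ (or_introl erefl)) (d0 _ (or_intror erefl)).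
  have -> // : map (setflag false) [seq nth (Leaf 0) ts i | i <- invlist sigma]
      = [seq nth (Leaf 0) (map (setflag false) ts) i | i <- invlist sigma].
  rewrite -map_comp; apply/eq_in_map => i /invlist_lt h /=.
  by rewrite (nth_map (Leaf 0)) // sz.
- rewrite feval_fmap /feval; move/trel_not_leaf: hx.
  elim: x => [_|[c t] x IH /andP[nl /IH hx]].
    exact: big_nil.
  rewrite big_cons hx addr0 /= /kappa_tree; case: ifP => [|_]; last exact: scaler0.
  case/andP => /andP[_]; rewrite all_cat => /andP[_ /andP[pt _]] /eqP[].
  rewrite map_cat sumn_cat /= => /eqP; rewrite !addn_eq0 => /and3P[_ wt _].
  by case/negP: nl; apply/andP.
- by rewrite feval_fmap /feval big1 // => p _; rewrite scaler0.
Qed.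

Lemma kappa_fc (x : fsum) : kappa (fc x) = feval kappa_tree x.
Proof. exact: feval_frepr kappa_tree_rel. Qed.

Lemma kappa_unit : kappa (kunit Q) = 0.
Proof. by rewrite kappa_fc /feval big_seq1 scaler0. Qed.

Lemma kappa_susp r m (mu : E r m) : kappa (susp mu) = generator mu.
Proof.
rewrite kappa_fc /feval big_seq1 scale1r /kappa_tree /=.
have -> : all (tpure true) [seq Leaf a | a <- iota 0 r] by elim: (iota 0 r).
have -> : sumn (map (@weight k E) [seq Leaf a | a <- iota 0 r]) = 0%N.
  by elim: (iota 0 r).
by rewrite -map_comp.
Qed.

End Kappa.

(** * Multilinear maps, horizontal components and homology classes *)

Section Multilinear.
Variables (k : comPzRingType) (A B : lmodType k) (r : nat) (g : seq A -> B).
Hypothesis gL : multilinear r g.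

Lemma mlin0 xs ys : (size xs + size ys).+1 = r -> g (xs ++ 0 :: ys) = 0.
Proof.
move=> sz; have := gL 1 0 0 sz; rewrite scale1r addr0 scale1r => h.
by apply: (addIr (g (xs ++ 0 :: ys))); rewrite -h add0r.
Qed.

Lemma mlinZ xs ys c x : (size xs + size ys).+1 = r ->
  g (xs ++ c *: x :: ys) = c *: g (xs ++ x :: ys).
Proof. by move=> sz; have := gL c x 0 sz; rewrite addr0 mlin0 // addr0. Qed.

End Multilinear.

Lemma mlin1D (k : comPzRingType) (A B : lmodType k) (g : seq A -> B) :
  multilinear 1 g -> linear (fun x => g [:: x]).
Proof. by move=> gL c x y; apply: (gL [::] [::]). Qed.

Lemma gproj_eq0 (k : comPzRingType) (V : lmodType k) (g : grading V) x :
  (forall p, gproj g p x = 0) -> x = 0.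
Proof. by move=> h; have [s _ ->] := gproj_sum g x; apply: big1. Qed.

Lemma gproj_two (k : comPzRingType) (V : lmodType k) (g : grading V) a b x :
  a != b -> (forall p, p != a -> p != b -> gproj g p x = 0) ->
  x = gproj g a x + gproj g b x.
Proof.
move=> ab h; apply/eqP; rewrite -subr_eq0; apply/eqP/(gproj_eq0 (g := g)) => p.
rewrite raddfB raddfD /= !gproj_proj.
have [->|pa] := eqVneq p a; first by rewrite (negPf ab) addr0 subrr.
have [->|pb] := eqVneq p b; first by rewrite add0r subrr.
by rewrite h // addr0 subr0.
Qed.

Section Horizontal.
Variable k : comPzRingType.

Lemma hproj_neg (A : dcomplex k) p (x : A) : (p < 0)%O -> hproj A p x = 0.
Proof. exact: hgr_neg. Qed.

(** Of the tuples of horizontal degrees over which a component is summed, only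
    that of the arguments contributes: for any other tuple some argument is
    projected to 0. *)
Lemma hcomp_homogeneous (A B : dcomplex k) r i (g : seq A -> B) ps xs :
  multilinear r g -> size xs = r -> size ps = r ->
  (forall j, (j < r)%N -> hproj A (nth 0 ps j) (nth 0 xs j) = nth 0 xs j) ->
  hcomp i g xs = hproj B (zsum ps - i) (g xs).
Proof.
move=> gL sx sp hx.
have hmap : [seq hproj A p.1 p.2 | p <- zip ps xs] = xs.
  apply: (@eq_from_nth _ 0); rewrite size_map size_zip sx sp minnn //.
  move=> j hj; rewrite (nth_map (0, 0)) ?size_zip ?sx ?sp ?minnn //.
  by rewrite nth_zip ?sx ?sp //= hx.
rewrite /hcomp -(fsbig_widen [set ps]).
- by rewrite fsbig_set1 hmap.
- by move=> _ -> /=; rewrite sx.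
move=> qs /= [sq /eqP neq]; rewrite sx in sq.
have [j hj nj] : exists2 j, (j < r)%N & nth 0 qs j != nth 0 ps j.
  apply: contrapT => h; apply: (negP neq); apply/eqP.
  apply: (@eq_from_nth _ 0); rewrite sq ?sp // => j hj.
  by apply: contrapT => /eqP nj; apply: h; exists j.
set zs := map _ _.
have sz : size zs = r by rewrite size_map size_zip sx sq minnn.
rewrite -[zs](cat_take_drop j) (@drop_nth _ 0 j) ?sz //.
have -> : nth 0 zs j = 0.
  rewrite (nth_map (0, 0)) ?size_zip ?sx ?sq ?minnn // nth_zip ?sx ?sq //=.
  by rewrite -hx // /hproj gproj_proj (negPf nj).
by rewrite (mlin0 gL) ?raddf0 // size_take_drop ?sz.
Qed.

Lemma dcomp_homogeneous (A : dcomplex k) i p (x : A) :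
  hproj A p x = x -> dcomp i x = hproj A (p - i) (cd A x).
Proof.
move=> hx; rewrite /dcomp (@hcomp_homogeneous _ _ 1 _ _ [:: p]) //.
- by rewrite /zsum big_seq1.
- by case=> [|? ?] [|? ?] c y z //= _; rewrite linearP.
- by case.
Qed.

End Horizontal.

Section HomologyClass.
Variables (k : comPzRingType) (A : complex k).
Implicit Types x y : A.

Lemma hclassE x (h : cd A x = 0) :
  hclass x = pcls (exist _ x h : pm_car (homology_pm A)).
Proof.
by rewrite /hclass; case: pselect => // h'; rewrite (Prop_irrelevance h' h).
Qed.

Lemma hclass_linear c x y : cd A x = 0 -> cd A y = 0 ->
  hclass (c *: x + y) = c *: hclass x + hclass y.
Proof.
move=> hx hy; have h : cd A (c *: x + y) = 0 by rewrite linearP /= hx hy scaler0 addr0.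
rewrite (hclassE hx) (hclassE hy) (hclassE h).
rewrite -[RHS]/(pq_add (pq_scale c (pcls _)) (pcls _)) pq_scaleE pq_addE.
by apply/pclsP/homologous_eq.
Qed.

Lemma hclass0 : hclass (0 : A) = 0.
Proof.
have h : cd A 0 = 0 by rewrite raddf0.
by rewrite (hclassE h); apply/pclsP/homologous_eq.
Qed.

Lemma hclass_sum (I : Type) (s : seq I) (c : I -> k) (F : I -> A) :
  (forall i, cd A (F i) = 0) ->
  hclass (\sum_(i <- s) c i *: F i) = \sum_(i <- s) c i *: hclass (F i).
Proof.
move=> h; elim: s => [|i s IH]; first by rewrite !big_nil hclass0.
rewrite !big_cons hclass_linear ?IH // linear_sum big1 //= => j _.
by rewrite linearZ /= h scaler0.
Qed.

Lemma hclass_boundary x y : cd A x = 0 -> hclass (x + cd A y) = hclass x.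
Proof.
move=> hx; have h : cd A (x + cd A y) = 0 by rewrite raddfD /= hx cdd addr0.
rewrite (hclassE h) (hclassE hx); apply/pclsP; exists y => /=.
by rewrite addrC addKr.
Qed.

End HomologyClass.

(** * The equations of an infinity-morphism on 1 and on generators *)

Lemma end_perm_iota (k : comPzRingType) (A B : lmodType k) r
    (g : seq int -> seq A -> B) ds xs : size ds = r -> size xs = r ->
  end_perm (iota 0 r) g ds xs = g ds xs.
Proof.
move=> sd sx; rewrite /end_perm kexp_iota ksgn0 scale1r.
by rewrite !map_nth_iota0 ?sd ?sx // -{1}sd -sx !take_size.
Qed.

Lemma end_tens_nseq (k : comPzRingType) (A B : complex k) (h : seq A -> B)
    acc r ds (xs : seq A) : size xs = r ->
  end_tens acc (nseq r (1%N, 0, h)) ds xs = (0, [seq h [:: x] | x <- xs]).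
Proof.
elim: r acc ds xs => [|r IH] acc ds [|x xs] //= [sx].
by rewrite drop0 IH //= mul0r addr0 take0.
Qed.

Section InfinityMorphisms.
Variables (k : comPzRingType) (Q : quadratic_data k).
Local Notation E := (qE Q).

Lemma ga_act0 (A : dgalg Q) (xs : seq A) : ga_act 0 xs = 0.
Proof.
have [lin _ _] := ga_smap A.
have h0 : operad Q (size xs) 0 0 by exists [::].
have := lin _ 0 xs erefl 1 0 0 h0 h0; rewrite !scale1r addr0 => h.
by apply: (addIr (ga_act 0 xs)); rewrite -h add0r.
Qed.

Lemma operad_generator r m (mu : E r m) : operad Q r m (generator mu).
Proof.
exists (tone (corolla false mu)) => //.
by have := node_fhom false mu 1 (permlist_iota r); rewrite addr0.
Qed.

Lemma smap_multilinear (RR : nat -> fsum k (tree E) -> Prop) b C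
    (A B : complex k) e (phi : trees RR -> seq A -> B) r n xi :
  is_smap b C e phi -> C r n xi -> multilinear r (phi xi).
Proof. by case=> _ h _ /h []. Qed.

Variables (A : complex k) (phi : ftrees E -> seq A -> A) (B : dgalg Q).
Variable f : ftrees E -> seq A -> B.
Hypothesis phi_alg : is_hoalg phi.
Hypothesis f_mor : is_infmor phi (ga_hoact (A := B)) f.

Let phi_unit x : phi (kunit Q) [:: x] = 0.
Proof. by case: phi_alg. Qed.

Lemma infmor_multilinear r n xi : kdual Q r n xi -> multilinear r (f xi).
Proof. by case: f_mor => h _; exact: smap_multilinear h. Qed.

(** Every term of the two decompositions of 1 contains the action of 1 on the
    source or on the target, and both are 0; what remains says that f(1) is a
    chain map. *)
Lemma infmor_unit n x : ghom (cgr A) n x ->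
  cd B (f (kunit Q) [:: x]) = f (kunit Q) [:: cd A x].
Proof.
move=> hx; have [_ eqf] := f_mor.
have hs : homs [:: n] [:: x] by split=> // -[].
have fL := infmor_multilinear (kdual_unit Q).
have {eqf} := eqf 1%N 0 (tone (Leaf 0)) _ _ [:: n] [:: x] erefl (kdual_unit Q)
  (unit_idecomposes Q) (low_terms_decompose (low_leaf Q)) erefl hs.
rewrite !big_seq1 ksgn0 scale1r !(@end_perm_iota _ _ _ 1) //.
rewrite /end_diff big_ord1 /= zsum_nil !ksgn0 !scale1r.
rewrite /end_pcomp /= phi_unit (mlin0 (xs := [::]) fL) // scaler0.
rewrite /end_comp /ga_hoact kappa_unit ga_act0 scaler0 subr0.
by move/eqP; rewrite subr_eq0 => /eqP.
Qed.

(** All composites in the two decompositions of s mu involve the action of 1, which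
    is 0, except f(1) after s mu, and mu after f(1) on each input. *)
Lemma infmor_susp r m (mu : E r m) ds xs : size xs = r -> homs ds xs ->
  end_diff (m + 1) (f (susp mu)) ds xs
    = f (kunit Q) [:: phi (susp mu) xs]
      - ga_act (generator mu) [seq f (kunit Q) [:: x] | x <- xs].
Proof.
move=> sx hs; have [_ eqf] := f_mor; have [sd _] := hs; rewrite sx in sd.
have fL := infmor_multilinear (kdual_susp mu).
rewrite (eqf r (m + 1) (tone (corolla true mu)) _ _ ds xs _ (kdual_susp mu)
  (susp_idecomposes mu) (low_terms_decompose (low_tree_corolla mu)) sx hs); last first.
  exact: low_tree_fhom (low_tree_corolla mu).
congr (_ - _).
  rewrite big_cons /= ksgn0 scale1r end_perm_iota // /end_pcomp /=.
  rewrite !take0 zsum_nil mulr0 ksgn0 scale1r drop0 add0n.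
  rewrite take_oversize ?drop_oversize ?sx //.
  rewrite big_map big1_seq ?addr0 // => i; rewrite mem_iota /= => hi.
  rewrite end_perm_iota // /end_pcomp /= (@drop_nth _ 0 i) ?sx //.
  rewrite [take 1 _]/= take0 phi_unit.
  by rewrite (mlin0 fL) ?scaler0 // addn1 size_take_drop sx.
rewrite 2!big_cons big_nil addr0 /= end_perm_iota // flatten_leaves end_perm_iota //.
rewrite /end_comp /= /ga_hoact kappa_unit ga_act0 scaler0 add0r.
by rewrite map_nseq end_tens_nseq //= ksgn0 scale1r kappa_susp.
Qed.

End InfinityMorphisms.

(** * Families with one modified entry *)

Section Replace.
Variables (V : Type) (r : nat).
Implicit Types (x : 'I_r -> V) (i : 'I_r) (y : V).

Definition ord_list x : seq V := [seq x j | j <- enum 'I_r].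

Lemma size_ord_list x : size (ord_list x) = r.
Proof. by rewrite size_map size_enum_ord. Qed.

Lemma size_replace x i y : size (replace x i y) = r.
Proof. by rewrite size_map size_enum_ord. Qed.

Lemma nth_ord_list d x (j : 'I_r) : nth d (ord_list x) j = x j.
Proof. by rewrite (nth_map j) ?size_enum_ord // nth_ord_enum. Qed.

Lemma nth_replace d x i y (j : 'I_r) :
  nth d (replace x i y) j = if j == i then y else x j.
Proof. by rewrite (nth_map j) ?size_enum_ord // nth_ord_enum. Qed.

Lemma ord_list_split x i :
  ord_list x = take i (ord_list x) ++ x i :: drop i.+1 (ord_list x).
Proof.
by rewrite -{1}(nth_ord_list (x i) x i) -drop_nth ?size_ord_list // cat_take_drop.
Qed.

Lemma replaceE x i y :
  replace x i y = take i (ord_list x) ++ y :: drop i.+1 (ord_list x).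
Proof.
have sz : size (take i (ord_list x)) = i by rewrite size_take size_ord_list ltn_ord.
apply: (@eq_from_nth _ y).
  by rewrite size_replace -{1}(size_ord_list x) {1}(ord_list_split x i) !size_cat.
move=> j0; rewrite size_replace => hj.
have [j ->] : exists j : 'I_r, j0 = j by exists (Ordinal hj).
rewrite nth_replace nth_cat sz; case: (ltngtP j i) => [ji|ij|/val_inj ->].
- by rewrite nth_take // nth_ord_list ifN // neq_ltn ji.
- rewrite ifN ?neq_ltn ?ij ?orbT // -(subnSK ij) /= nth_drop addSn -addnS subnSK //.
  by rewrite subnKC ?(ltnW ij) // nth_ord_list.
- by rewrite eqxx subnn.
Qed.

Lemma take_replace x i y : take i (replace x i y) = take i (ord_list x).
Proof. by rewrite replaceE take_size_cat // size_take size_ord_list ltn_ord. Qed.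

Lemma drop_replace x i y : drop i.+1 (replace x i y) = drop i.+1 (ord_list x).
Proof.
rewrite replaceE drop_cat size_take size_ord_list ltn_ord ltnNge leqnSn subSnn /=.
exact: drop0.
Qed.

End Replace.

Lemma map_replace (V W : Type) r (g : V -> W) (x : 'I_r -> V) i y :
  map g (replace x i y) = replace (fun j => g (x j)) i (g y).
Proof. by rewrite /replace -map_comp; apply: eq_map => j /=; case: ifP. Qed.

Lemma zsum_replace r (d : 'I_r -> int) i b :
  zsum (replace d i b) = \sum_(j < r) d j + (b - d i).
Proof.
rewrite /zsum big_map big_enum /= (bigD1 i) //= [in RHS](bigD1 i) //= eqxx.
rewrite (eq_bigr d); last by move=> j /negPf ->.
by rewrite [RHS]addrC addrA subrK.
Qed.

Lemma zsum_take_ord_list r (d : 'I_r -> int) (i : 'I_r) :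
  zsum (take i (ord_list d)) = \sum_(j < r | (j < i)%N) d j.
Proof.
transitivity (\sum_(0 <= j < i) nth 0 (ord_list d) j).
  rewrite /zsum (big_nth 0) size_take size_ord_list ltn_ord !big_nat.
  by apply: eq_bigr => j /= ji; rewrite nth_take.
rewrite big_mkord (big_ord_widen r) ?(ltnW (ltn_ord i)) //.
by apply: eq_bigr => j _; rewrite nth_ord_list.
Qed.

(** Only the differential of the modified entry survives.  The sign of passing the
    differential through [g] and the preceding entries is -(-1)^(beta_i). *)
Lemma end_diff_replace (k : comPzRingType) (A B : complex k) (r : nat) (m : int)
    (g : seq A -> B) (deg : 'I_r -> int) (u : 'I_r -> A) (i : 'I_r) (v : A) (t : k) b :
  multilinear r g -> (forall j, cd A (u j) = 0) -> cd A v = t *: u i ->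
  end_diff (m + 1) g (replace deg i b) (replace u i v)
    = cd B (g (replace u i v)) + (ksgn k (beta m deg i) * t) *: g (ord_list u).
Proof.
move=> gL du dv; rewrite /end_diff ksgnD1 scaleNr opprK; congr (_ + _).
have sz (j : 'I_r) :
    (size (take j (replace u i v)) + size (drop j.+1 (replace u i v))).+1 = r.
  by rewrite size_take_drop size_replace.
pose F j := ksgn k (zsum (take j (replace deg i b))) *:
  g (take j (replace u i v) ++ cd A (nth 0 (replace u i v) j)
       :: drop j.+1 (replace u i v)).
rewrite -(big_mkord xpredT F) size_replace big_mkord (bigD1 i) //=.
rewrite [X in _ + X]big1 ?addr0 => [|j /negPf ji].
  rewrite /F !take_replace drop_replace nth_replace eqxx dv (mlinZ gL); last first.
    by rewrite -(take_replace _ _ v) -(drop_replace _ _ v).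
  by rewrite -ord_list_split zsum_take_ord_list !scalerA -ksgnD.
by rewrite /F nth_replace ji du (mlin0 gL) ?scaler0.
Qed.

(** * The derived minimal model *)

Lemma filt_homogeneous (k : comPzRingType) (A : dcomplex k) p (x : A) :
  hproj A p x = x -> filt p x.
Proof. by move=> hx q pq; rewrite -hx /hproj gproj_proj gt_eqF. Qed.

Lemma filt1_split (k : comPzRingType) (A : dcomplex k) (x : A) :
  filt 1 x -> x = hproj A 1 x + hproj A 0 x.
Proof.
move=> h; apply: (gproj_two (g := hgr (dc_sp A))) => // q q1 q0.
have [|q2] := ltP q 0; first exact: hproj_neg.
apply: h; lia.
Qed.

Section TorsionMassey.
Variables (k : comPzRingType) (Q : quadratic_data k) (A : dgalg Q) (At : dhalg Q).
Variable f : ftrees (qE Q) -> seq At -> concentrated A.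
Hypothesis fmin : derived_minimal_model f.

Local Notation f1 := (fun x : At => f (kunit Q) [:: x] : A).

Let f_mor : is_infmor (dh_act (d := At)) (ga_hoact (A := A)) f.
Proof. by case: fmin => -[]. Qed.

Lemma model_multilinear r n xi : kdual Q r n xi -> multilinear r (f xi).
Proof. by move=> h; exact: (infmor_multilinear f_mor h). Qed.

Lemma model_unit_linear : linear f1.
Proof. exact/mlin1D/model_multilinear/kdual_unit. Qed.

(** The target is concentrated in horizontal degree 0, so no part of f(1)(y) is
    lost when y has horizontal degree 0. *)
Lemma f1_0_base (y : At) : hproj At 0 y = y -> f1_0 f y = f1 y.
Proof.
move=> hy; rewrite /f1_0 (@hcomp_homogeneous _ _ _ 1 _ _ [:: 0]) //.
- by rewrite /zsum big_seq1.
- exact/model_multilinear/kdual_unit.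
- by case.
Qed.

(** Minimality: the differential strictly lowers the horizontal degree. *)
Lemma cd_top (p : int) (x : At) : hproj At p x = x ->
  forall q, p <= q -> hproj At q (cd At x) = 0.
Proof.
move=> hx q; rewrite le_eqVlt => /orP[/eqP <-|].
  by have := mm_minimal fmin x; rewrite (dcomp_homogeneous _ hx) subr0.
exact: (dh_filt_d (filt_homogeneous hx)).
Qed.

Lemma cd_base (x : At) : hproj At 0 x = x -> cd At x = 0.
Proof.
move=> hx; apply: (gproj_eq0 (g := hgr (dc_sp At))) => q.
by have [q0|q0] := ltP q 0; [exact: hproj_neg | exact: (cd_top hx)].
Qed.

Lemma cd_level1 (x : At) : hproj At 1 x = x -> cd At x = dcomp 1 x.
Proof.
move=> hx; rewrite (dcomp_homogeneous _ hx) subrr.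
have h q : 1 < q -> hproj At q (cd At x) = 0.
  by move=> q1; apply: (cd_top hx); exact: ltW.
rewrite [LHS](filt1_split h).
by rewrite (cd_top hx) // add0r.
Qed.

Lemma cd_level2 (x : At) : hproj At 2 x = x -> cd At x = dcomp 1 x + dcomp 2 x.
Proof.
move=> hx; rewrite !(dcomp_homogeneous _ hx) subrr.
apply: filt1_split => q q1; apply: (cd_top hx); lia.
Qed.

(** The equation of the infinity-morphism on s mu, solved for the i-th term of the
    Massey cycle. *)
Lemma massey_term r (m : int) (mu : qE Q r m) (deg : 'I_r -> int) (t : k)
    (u : 'I_r -> At) (i : 'I_r) (v : At) :
  (forall j, bihom 0 (deg j) (u j)) -> bihom 1 (deg i) v ->
  dcomp 1 v = t *: u i ->
  ksgn k (beta m deg i) *: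
      ga_act (generator mu) (replace (fun j => f1 (u j)) i (f1 v))
    = ksgn k (beta m deg i) *: f1 (dh_act (susp mu) (replace u i v))
      - cd A (ksgn k (beta m deg i) *: f (susp mu) (replace u i v))
      - t *: (f (susp mu) (ord_list u) : A).
Proof.
move=> hu [hv hv1] dv.
have hs : homs (replace deg i (deg i + 1)) (replace u i v).
  split; rewrite !size_replace // => j0 hj.
  have [j ->] : exists j : 'I_r, j0 = j by exists (Ordinal hj).
  rewrite !nth_replace; case: eqP => _; first by rewrite addrC.
  by have [] := hu j; rewrite add0r.
have := infmor_susp (dh_hoalg At) f_mor mu (size_replace u i v) hs.
rewrite (@end_diff_replace _ _ _ _ _ _ _ _ _ _ t); first last.
- by rewrite cd_level1.
- by move=> j; apply: cd_base; case: (hu j).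
- exact/model_multilinear/kdual_susp.
rewrite map_replace => /eqP; rewrite eq_sym subr_eq addrC -subr_eq => /eqP <-.
rewrite opprD !scalerDr [cd A (_ *: _)]linearZ /= !scalerN scalerA mulrA ksgnK.
by rewrite mul1r addrA.
Qed.

(** The arguments have total horizontal degree 1, so at most the horizontal degrees
    1 and 0 occur in the value. *)
Lemma susp_components r (m : int) (mu : qE Q r m) (deg : 'I_r -> int)
    (u : 'I_r -> At) (i : 'I_r) (v : At) :
  (forall j, bihom 0 (deg j) (u j)) -> bihom 1 (deg i) v ->
  let P := dh_act (susp mu) (replace u i v) in
  [/\ ghom (cgr At) (m + \sum_(j < r) deg j + 1) P, filt 1 P,
      hcomp 0 (dh_act (susp mu)) (replace u i v) = hproj At 1 P
    & hcomp 1 (dh_act (susp mu)) (replace u i v) = hproj At 0 P].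
Proof.
move=> hu [hv hv1] P.
have [smap _ _] := dh_hoalg At; have [_ deg_phi _] := smap.
have hps j0 : (j0 < r)%N ->
    hproj At (nth 0 (replace (fun=> 0) i 1) j0) (nth 0 (replace u i v) j0)
      = nth 0 (replace u i v) j0.
  move=> hj; have [j ->] : exists j : 'I_r, j0 = j by exists (Ordinal hj).
  by rewrite !nth_replace; case: eqP => // _; case: (hu j).
have zps : zsum (replace (fun=> 0) i 1) = 1.
  by rewrite zsum_replace big1 // add0r subr0.
have comp p : hcomp p (dh_act (susp mu)) (replace u i v) = hproj At (1 - p) P.
  rewrite (@hcomp_homogeneous _ _ _ r _ _ (replace (fun=> 0) i 1)) ?size_replace //.
    by rewrite zps.
  exact: smap_multilinear smap (kdual_susp mu).
split; rewrite ?comp //.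
- have [_ h] := deg_phi _ _ _ (kdual_susp mu).
  have {h} := h (replace deg i (deg i + 1)) (replace u i v) (size_replace _ _ _).
  have -> : zsum (replace deg i (deg i + 1)) + (m + 1 + -1)
      = m + \sum_(j < r) deg j + 1.
    by rewrite zsum_replace addrK (addrC (deg i)) addrK addrC addrA.
  apply; split; rewrite !size_replace // => j0 hj.
  have [j ->] : exists j : 'I_r, j0 = j by exists (Ordinal hj).
  rewrite !nth_replace; case: eqP => _; first by rewrite addrC.
  by have [] := hu j; rewrite add0r.
- rewrite -zps; apply: (dh_filt (kdual_susp mu)); rewrite ?size_replace // => j hj.
  exact/filt_homogeneous/hps.
Qed.

End TorsionMassey.

(** * Torsion Massey products in the minimal model *)

Theorem theorem6p3 (k : comPzRingType) (Q : quadratic_data k)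
  (HQ : standing_assumptions Q) (A : dgalg Q) (At : dhalg Q)
  (f : ftrees (qE Q) -> seq At -> concentrated A)
  (Hf : derived_minimal_model f)
  (r : nat) (m : int) (mu : qE Q r m)
  (deg : 'I_r -> int) (x : 'I_r -> homology A) (t : 'I_r -> k)
  (Hx : forall i, hdeg (deg i) (x i))
  (Htx : forall i, t i *: x i = 0)
  (Ht : \sum_(i < r) t i = 0)
  (u v : 'I_r -> At) (w : At)
  (Hu : forall i, bihom 0 (deg i) (u i))
  (Hux : forall i, represents (f1_0 f (u i)) (x i))
  (Hv : forall i, bihom 1 (deg i) (v i))
  (Hdv : forall i, dcomp 1 (v i) = t i *: u i)
  (Hw : bihom 2 (m + \sum_(i < r) deg i) w)
  (Hdw : dcomp 1 w = \sum_(i < r) ksgn k (beta m deg i) *: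
           hcomp 0 (dh_act (susp mu)) (replace u i (v i))) :
  massey mu deg x t
    (\sum_(i < r) ksgn k (beta m deg i) *:
       rho f (hcomp 1 (dh_act (susp mu)) (replace u i (v i)))
     - rho f (dcomp 2 w)).
Proof.
pose f1 (y : At) : A := f (kunit Q) [:: y].
have f1L : linear f1 := model_unit_linear Hf.
pose F : {linear At -> A} := HB.pack f1 (GRing.isLinear.Build k At A *:%R f1 f1L).
have f_mor : is_infmor (dh_act (d := At)) (ga_hoact (A := A)) f by case: Hf => -[].
have f_deg n y : ghom (cgr At) n y -> ghom (cgr A) n (f1 y).
  move=> hy; have [[_ deg_f _] _] := f_mor.
  have [_ /(_ [:: n] [:: y] erefl)] := deg_f _ _ _ (kdual_unit Q).
  by rewrite /zsum big_seq1 !addr0; apply; split=> // -[].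
have f_cd n y : ghom (cgr At) n y -> cd A (f1 y) = f1 (cd At y).
  exact: infmor_unit (dh_hoalg At) f_mor _ _.
pose eps i := ksgn k (beta m deg i).
pose P i := dh_act (susp mu) (replace u i (v i)).
have uE i : f1_0 f (u i) = f1 (u i) by apply: f1_0_base => //; case: (Hu i).
have zE i : cd A (f1 (v i)) = t i *: f1 (u i).
  have [vn v1] := Hv i.
  by rewrite (f_cd _ _ vn) (cd_level1 Hf v1) Hdv -[f1]/(F : _ -> _) linearZ.
(* With these choices the class below is hit exactly, so the indeterminacy is 0. *)
exists (fun i => f1 (u i)), (fun i => f1 (v i)), (fun=> 0), (fun=> 0); split.
- move=> i; split; last by rewrite -uE.
  by apply: f_deg; have [] := Hu i; rewrite add0r.
- move=> i; split; last exact: zE.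
  by apply: f_deg; have [] := Hv i; rewrite addrC.
- by move=> i; exists 0; [exact: raddf0 | split; [exact: raddf0 | exact: hclass0]].
- move=> i; exists (replace (fun j => f1 (u j)) i 0).
    split.
      split; rewrite !size_replace // => j0 hj.
      have [j ->] : exists j : 'I_r, j0 = j by exists (Ordinal hj).
      rewrite !nth_replace; case: eqP => _; first exact: raddf0.
      by apply: f_deg; have [] := Hu j; rewrite add0r.
    rewrite /replace; elim: (enum 'I_r) => //= j s IH; constructor => //.
    by case: eqP => _; [split; [exact: raddf0 | exact: hclass0] | rewrite -uE].
  rewrite replaceE (mlin0 (smap_multilinear (ga_smap A) (operad_generator mu))).
    by rewrite hclass0.
  by rewrite size_take_drop size_ord_list.
have comps i := susp_components mu Hu (Hv i).
have [wn w2] := Hw.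
have Hcw := cd_level2 Hf w2.
have rhoE y : hproj At 0 y = y -> rho f y = hclass (f1 y).
  by move=> y0; rewrite /rho f1_0_base.
have f1_cycle n y : hproj At 0 y = y -> ghom (cgr At) n y -> cd A (f1 y) = 0.
  move=> y0 yn; rewrite (f_cd _ _ yn) (cd_base Hf y0).
  by rewrite -[f1]/(F : _ -> _) raddf0.
set b := fun i => hcomp 1 (dh_act (susp mu)) (replace u i (v i)).
have b0 i : hproj At 0 (b i) = b i.
  by have [_ _ _ e] := comps i; rewrite /b e /hproj gproj_proj.
have c0 : hproj At 0 (dcomp 2 w) = dcomp 2 w.
  by rewrite (dcomp_homogeneous _ w2) /hproj gproj_proj.
have ghom_hproj p n y : ghom (cgr At) n y -> ghom (cgr At) n (hproj At p y).
  by move=> yn; rewrite /ghom /hproj -hgr_comm yn.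
have b_cycle i : cd A (f1 (b i)) = 0.
  apply: f1_cycle (b0 i) _; have [Pn _ _ e] := comps i.
  by rewrite /b e; apply: ghom_hproj Pn.
have c_cycle : cd A (f1 (dcomp 2 w)) = 0.
  apply: f1_cycle c0 _; rewrite (dcomp_homogeneous _ w2); apply: ghom_hproj.
  exact: cd_deg wn.
rewrite [X in _ = _ + X]big1 // addr0 (rhoE _ c0).
rewrite (eq_bigr (fun i => eps i *: hclass (f1 (b i)))); last first.
  by move=> i _; rewrite (rhoE _ (b0 i)).
rewrite -(hclass_sum _ _ b_cycle) addrC -scaleN1r -hclass_linear //; last first.
  by rewrite linear_sum big1 // => i _; rewrite linearZ /= b_cycle scaler0.
pose G i : A := f (susp mu) (replace u i (v i)).
(* The two cycles differ by the boundary of this element. *)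
rewrite -[LHS](hclass_boundary (f1 w - \sum_(i < r) eps i *: G i)); last first.
  rewrite linearP /= c_cycle scaler0 add0r linear_sum big1 // => i _.
  by rewrite linearZ /= b_cycle scaler0.
congr hclass.
rewrite [RHS](eq_bigr _ (fun i _ => massey_term Hf mu Hu (Hv i) (Hdv i))).
(* The values on (u_1, ..., u_r) cancel because the t_i add up to 0. *)
rewrite !big_split /= !sumrN -scaler_suml Ht scale0r subr0.
rewrite -linear_sum linearB /= addrA; congr (_ - _).
have -> : \sum_(i < r) ksgn k (beta m deg i) *: f1 (P i)
   = F (dcomp 1 w) + \sum_(i < r) eps i *: f1 (b i).
  rewrite Hdw linear_sum -big_split /=; apply: eq_bigr => i _.
  have [_ Pf e1 e0] := comps i.
  by rewrite -[f1]/(F : _ -> _) linearZ_LR -scalerDr -raddfD /b e1 e0 -(filt1_split Pf).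
rewrite (f_cd _ _ wn) Hcw -[f1]/(F : _ -> _) linearD scaleN1r.
by rewrite [LHS]addrC addrA addrK.
Qed.
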